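(* Let $E$ be a solid translation-invariant Banach function space of bounded type on $\mathbb{R}^n$, let $\mathfrak{M},\mathfrak{N}$ be weight sequence systems and let $\mathcal{W},\mathcal{V}$ be weight function systems. Assume that $\mathfrak{M}$ satisfies $[\mathrm{L}]$ and $[\mathrm{wI}]$, $\mathfrak{N}$ satisfies $[\mathrm{L}]$, $\mathcal{W}$ satisfies $[\mathrm{M}]$, and $\mathcal{V}$ satisfies $[\mathrm{wM}]$. Suppose that $E^{[\mathfrak{M}]}_{[\mathcal{W}]}\neq\{0\}$. If $E^{[\mathfrak{M}]}_{[\mathcal{W}]}\subseteq E^{[\mathfrak{N}]}_{[\mathcal{V}]}$ as sets, then $\mathcal{W}\,[\subseteq]\,\mathcal{V}$.
   Context: Conventions: $\mathbb{N}=\{0,1,2,\dots\}$, $\mathbb{R}_+=(0,\infty)$, $T_xf(t)=f(t-x)$, $B(0,1)=\{x\in\mathbb{R}^n:|x|<1\}$. The symbol $[\,\cdot\,]$ is a common notation for $(\,\cdot\,)$ (Beurling case) and $\{\,\cdot\,\}$ (Roumieu case): the statement is asserted twice, once with all $[\,\cdot\,]$ replaced by $(\,\cdot\,)$ and once with all replaced by $\{\,\cdot\,\}$. Banach function spaces. A Banach space $E$ is a translation-invariant Banach function space (TIBF) of bounded type on $\mathbb{R}^n$ if $E\neq\{0\}$, $E\subseteq L^1_{\mathrm{loc}}(\mathbb{R}^n)$ continuously, $T_xE\subseteq E$ for all $x\in\mathbb{R}^n$, there is $C_0>0$ with $\|T_xf\|_E\le C_0\|f\|_E$ for all $x\in\mathbb{R}^n$,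 $f\in E$, and $E*C_c(\mathbb{R}^n)\subseteq E$. It is solid if $f\in E$, $g\in L^1_{\mathrm{loc}}(\mathbb{R}^n)$ and $|g|\le|f|$ a.e. imply $g\in E$ and $\|g\|_E\le\|f\|_E$. Weight function systems. A weight function is a continuous $w:\mathbb{R}^n\to[1,\infty)$. A weight function system is a family $\mathcal{W}=\{w^\lambda:\lambda\in\mathbb{R}_+\}$ of weight functions with $w^\lambda\le w^\mu$ pointwise whenever $\mu\le\lambda$ (and $\mathcal{V}=\{v^\lambda:\lambda\in\mathbb{R}_+\}$). Conditions: $(\mathrm{wM})$: $\forall\lambda\,\exists\mu\,\exists C>0\,\forall x\in\mathbb{R}^n,y\in B(0,1)$: $w^\lambda(x+y)\le Cw^\mu(x)$. $\{\mathrm{wM}\}$: $\forall\mu\,\exists\lambda\,\exists C>0\,\forall x\in\mathbb{R}^n,y\in B(0,1)$: $w^\lambda(x+y)\le Cw^\mu(x)$. $(\mathrm{M})$: $\forall\lambda\,\exists\mu,\nu\,\exists C>0\,\forall x,y\in\mathbb{R}^n$: $w^\lambda(x+y)\le Cw^\mu(x)w^\nu(y)$. $\{\mathrm{M}\}$: $\forall\mu,\nu\,\exists\lambda\,\exists C>0\,\forall x,y\in\mathbb{R}^n$: $w^\lambda(x+y)\le Cw^\mu(x)w^\nu(y)$. (Here $\lambda,\mu,\nu$ range over $\mathbb{R}_+$.) $\mathcal{W}(\subseteq)\mathcal{V}$ means $\forall\lambda\,\exists\mu$: $v^\lambda(t)=O(w^\mu(t))$; $\mathcal{W}\{\subseteq\}\mathcal{V}$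 means $\forall\mu\,\exists\lambda$: $v^\lambda(t)=O(w^\mu(t))$. Weight sequence systems. A weight sequence is a family $M=(M_\alpha)_{\alpha\in\mathbb{N}^n}$ of positive numbers with $M_0=1$ and $\lim_{|\alpha|\to\infty}M_\alpha^{1/|\alpha|}=\infty$. A weight sequence system is a family $\mathfrak{M}=\{M^\lambda:\lambda\in\mathbb{R}_+\}$ of weight sequences with $M^\lambda_\alpha\le M^\mu_\alpha$ for all $\alpha$ whenever $\lambda\le\mu$ (and $\mathfrak{N}=\{N^\lambda\}$). Conditions: $(\mathrm{L})$: $\forall R>0\,\forall\lambda\,\exists\mu\,\exists C>0\,\forall\alpha$: $R^{|\alpha|}M^\mu_\alpha\le CM^\lambda_\alpha$. $\{\mathrm{L}\}$: $\forall R>0\,\forall\mu\,\exists\lambda\,\exists C>0\,\forall\alpha$: $R^{|\alpha|}M^\mu_\alpha\le CM^\lambda_\alpha$. $(\mathrm{wI})$: $\forall\lambda\,\exists\mu\,\exists H>0\,\forall R>0\,\exists C>0\,\forall\alpha,\beta$: $M^\mu_\alpha R^{|\beta|}\le CH^{|\alpha+\beta|}M^\lambda_{\alpha+\beta}$. $\{\mathrm{wI}\}$: $\forall\mu\,\exists\lambda\,\exists H>0\,\forall R>0\,\exists C>0\,\forall\alpha,\beta$: $M^\mu_\alpha R^{|\beta|}\le CH^{|\alpha+\beta|}M^\lambda_{\alpha+\beta}$. Spaces. For a weight sequence $M$ and a weight function $w$, $E^M_w$ is the Banach space of all $f\in C^\infty(\mathbb{R}^n)$ with $f^{(\alpha)}w\in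 E$ for all $\alpha\in\mathbb{N}^n$ and $\|f\|_{E,M,w}=\sup_\alpha\|f^{(\alpha)}w\|_E/M_\alpha<\infty$. Then $E^{(\mathfrak{M})}_{(\mathcal{W})}=\varprojlim_{\lambda\to0^+}E^{M^\lambda}_{w^\lambda}$ (intersection over all $\lambda$, projective limit topology) and $E^{\{\mathfrak{M}\}}_{\{\mathcal{W}\}}=\varinjlim_{\lambda\to\infty}E^{M^\lambda}_{w^\lambda}$ (union over all $\lambda$, locally convex inductive limit topology). *)

(* Defs.v *)
From HB Require Import structures.
From mathcomp Require Import all_boot all_order all_algebra complex.
From mathcomp Require Import all_classical all_reals all_analysis.

Set Implicit Arguments.
Unset Strict Implicit.
Unset Printing Implicit Defensive.

Import Order.TTheory GRing.Theory Num.Theory.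
Import numFieldNormedType.Exports.

Local Open Scope classical_set_scope.
Local Open Scope ring_scope.

(* 'rV[R]_n carries the product sigma-algebra of the Borel sigma-algebra of R,
   that is, the Borel sigma-algebra of R^n (cf. the library's n.-tuple T). *)

Definition rV_display : measure_display.
Proof. exact: default_measure_display. Qed.

Section measurable_rV.
Context (R : realType) (n : nat).

Let coors : 'I_n -> 'rV[R]_n -> measurableTypeR R := fun i v => v ord0 i.

Let rV_set0 : g_sigma_preimage coors set0.
Proof. exact: sigma_algebra0. Qed.

Let rV_setC A : g_sigma_preimage coors A -> g_sigma_preimage coors (~` A).
Proof. exact: sigma_algebraC. Qed.

Let rV_bigcup (F : (set 'rV[R]_n)^nat) :
  (forall i, g_sigma_preimage coors (F i)) ->
  g_sigma_preimage coors (\bigcup_i (F i)).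
Proof. exact: sigma_algebra_bigcup. Qed.

HB.instance Definition _ :=
  @isMeasurable.Build rV_display 'rV[R]_n
    (g_sigma_preimage coors) rV_set0 rV_setC rV_bigcup.

End measurable_rV.

Section measurable_fun_rV.
Context (R : realType) (n : nat) d (T : measurableType d).

Lemma measurable_fun_rVP (f : T -> 'rV[R]_n) :
  measurable_fun [set: T] f <->
  forall i, measurable_fun [set: T] (fun x => f x ord0 i : measurableTypeR R).
Proof.
pose c (i : 'I_n) (v : 'rV[R]_n) : measurableTypeR R := v ord0 i.
apply: (@iff_trans _ (g_sigma_preimage (fun i => c i \o f) `<=` measurable)).
  rewrite g_sigma_preimage_comp; split=> [mf A [/= C preC <-]|prefS].
    exact: mf.
  by move=> _ A mA; apply: prefS; exists A.
split=> [cfS i|mf].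
- move=> _ A mA.
  apply: cfS; apply: sub_sigma_algebra.
  case: n i @c => [[] []//|m i] c in f *.
  rewrite -bigcup_mkord_ord.
  exists i; first exact: ltn_ord.
  by exists A => //; rewrite inord_val.
- apply: smallest_sub; first exact: sigma_algebra_measurable.
  case: n f mf @c => [|m] f mf c; first by rewrite big_ord0.
  rewrite -bigcup_mkord_ord; apply: bigcup_sub => i Ii.
  by move=> A [B mB <-]; exact: mf.
Qed.

End measurable_fun_rV.

(* Lebesgue measure on R^n, as an iterated product of Lebesgue measures on R;
   lebesgue_rV_box gives the volume of boxes. *)
Section lebesgue_rV.
Context (R : realType).

Lemma measurable_coord n (i : 'I_n) :
  measurable_fun [set: 'rV[R]_n] (fun v => v ord0 i : measurableTypeR R).
Proof. by have /measurable_fun_rVP := @measurable_id _ 'rV[R]_n setT. Qed.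

Definition cons_rV n (p : measurableTypeR R * 'rV[R]_n) : 'rV[R]_n.+1 :=
  row_mx p.1%:M p.2.

Definition uncons_rV n (v : 'rV[R]_n.+1) : measurableTypeR R * 'rV[R]_n :=
  (v ord0 ord0, rsubmx (v : 'rV[R]_(1 + n))).

Lemma cons_rV0 n p : @cons_rV n p ord0 ord0 = p.1.
Proof.
rewrite /cons_rV; have -> : @ord0 n = lshift n (@ord0 0) by exact/val_inj.
by apply: etrans (row_mxEl _ _ _ _) _; rewrite mxE mulr1n.
Qed.

Lemma cons_rVS n p i : @cons_rV n p ord0 (lift ord0 i) = p.2 ord0 i.
Proof.
rewrite /cons_rV; have -> : lift ord0 i = rshift 1 i by exact/val_inj.
exact: row_mxEr.
Qed.

Lemma cons_rVK n : cancel (@cons_rV n) (@uncons_rV n).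
Proof.
move=> [x v]; rewrite /uncons_rV cons_rV0; congr pair.
by rewrite /cons_rV row_mxKr.
Qed.

Lemma measurable_cons_rV n : measurable_fun setT (@cons_rV n).
Proof.
apply/measurable_fun_rVP => i.
have [j ->|->] := unliftP ord0 i.
  under eq_fun do rewrite cons_rVS.
  exact: (measurableT_comp (measurable_coord j) measurable_snd).
under eq_fun do rewrite cons_rV0.
exact: measurable_fst.
Qed.

Lemma measurable_uncons_rV n : measurable_fun setT (@uncons_rV n).
Proof.
apply: measurable_fun_pair; first exact: measurable_coord.
apply/measurable_fun_rVP => i.
under eq_fun do rewrite mxE.
exact: measurable_coord.
Qed.

Section step.
Context n (m : {sigma_finite_measure set 'rV[R]_n -> \bar R}).

Definition lebesgue_step : set 'rV[R]_n.+1 -> \bar R :=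
  pushforward (@lebesgue_measure R \x m)%E (@cons_rV n).

Let lebesgue_step0 : lebesgue_step set0 = 0%E.
Proof. by rewrite /lebesgue_step /pushforward preimage_set0 measure0. Qed.

Let lebesgue_step_ge0 A : (0 <= lebesgue_step A)%E.
Proof. by rewrite /lebesgue_step /pushforward; exact: measure_ge0. Qed.

Let lebesgue_step_sigma_additive : semi_sigma_additive lebesgue_step.
Proof.
have mc (A : set 'rV[R]_n.+1) : measurable A -> measurable (@cons_rV n @^-1` A).
  by move=> mA; rewrite -[X in measurable X]setTI; exact: measurable_cons_rV.
move=> F mF tF mUF; rewrite /lebesgue_step /pushforward preimage_bigcup.
apply: measure_semi_sigma_additive.
- by move=> i; exact: mc.
- apply/trivIsetP => /= i j _ _ ij; rewrite -preimage_setI.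
  by move/trivIsetP : tF => /(_ _ _ _ _ ij) ->//; rewrite preimage_set0.
- by rewrite -preimage_bigcup; exact: mc.
Qed.

HB.instance Definition _ := isMeasure.Build _ _ _ lebesgue_step
  lebesgue_step0 lebesgue_step_ge0 lebesgue_step_sigma_additive.

Let lebesgue_step_sigma_finite : sigma_finite setT lebesgue_step.
Proof.
have /sigma_finiteP[F [TF ndF Foo]] := sigma_finiteT (@lebesgue_measure R).
have /sigma_finiteP[G [TG ndG Goo]] := sigma_finiteT m.
exists (fun k => @uncons_rV n @^-1` (F k `*` G k)).
  apply/seteqP; split=> // v _.
  have [i _ Fi] : (\bigcup_i F i) (uncons_rV v).1 by rewrite -TF.
  have [j _ Gj] : (\bigcup_i G i) (uncons_rV v).2 by rewrite -TG.
  exists (maxn i j) => //; split.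
    by move: Fi; exact/subsetPset/ndF/leq_maxl.
  by move: Gj; exact/subsetPset/ndG/leq_maxr.
move=> k; have [mF Fk] := Foo k; have [mG Gk] := Goo k; split.
  rewrite -[X in measurable X]setTI.
  by apply: measurable_uncons_rV => //; exact: measurableX.
rewrite /lebesgue_step /pushforward -comp_preimage.
rewrite (_ : _ \o _ = id) ?preimage_id; last exact/funext/cons_rVK.
by rewrite product_measure1E// lte_mul_pinfty// ge0_fin_numE.
Qed.

HB.instance Definition _ := @Measure_isSigmaFinite.Build _ _ _ lebesgue_step
  lebesgue_step_sigma_finite.

End step.

Fixpoint lebesgue_rV n : {sigma_finite_measure set 'rV[R]_n -> \bar R} :=
  match n with
  | 0 => \d_(0 : 'rV[R]_0)
  | k.+1 => lebesgue_step (lebesgue_rV k)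
  end.

Lemma lebesgue_rV_box n (A : 'I_n -> set (measurableTypeR R)) :
  (forall i, measurable (A i)) ->
  lebesgue_rV n [set v | forall i, A i (v ord0 i)] =
  (\prod_(i < n) lebesgue_measure (A i))%E.
Proof.
elim: n A => [|n IH] A mA.
  by rewrite big_ord0 /= diracE mem_set// => -[].
rewrite big_ord_recl -IH; last by move=> i; exact: mA.
rewrite -product_measure1E//; last first.
  rewrite (_ : mkset _ = \bigcap_(i in [set: 'I_n])
      [set v | A (lift ord0 i) (v ord0 i)]); last first.
    by apply/seteqP; split=> v /= Av i => [_|]; exact: Av.
  apply: fin_bigcap_measurable => // i _.
  rewrite -[X in measurable X]setTI; exact: measurable_coord.
rewrite /= /lebesgue_step /pushforward; congr (_ _).
apply/seteqP; split=> [p /= Ap|p /= [Ap0 Ap] i].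
  split=> [|i]; first by have := Ap ord0; rewrite cons_rV0.
  by have := Ap (lift ord0 i); rewrite cons_rVS.
by have [j ->|->] := unliftP ord0 i; rewrite ?cons_rVS ?cons_rV0.
Qed.

End lebesgue_rV.

Section function_spaces.
Context (R : realType) (n : nat).

Local Notation normc := (@ComplexField.Normc.normc R).
Local Notation mu := (lebesgue_rV R n).
Local Notation fct := ('rV[R]_n -> R[i]).
Implicit Types (f g phi : fct) (E : set fct) (N : fct -> R).

Definition Re_fct f : 'rV[R]_n -> R := fun x => complex.Re (f x).
Definition Im_fct f : 'rV[R]_n -> R := fun x => complex.Im (f x).

Definition translate (x : 'rV[R]_n) f : fct := fun t => f (t - x).

Definition L1loc : set fct := [set f |
  [/\ measurable_fun setT (Re_fct f), measurable_fun setT (Im_fct f) &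
      forall K : set 'rV[R]_n, compact K ->
        (\int[mu]_(x in K) (normc (f x))%:E < +oo)%E]].

Definition Cc : set fct := [set phi |
  [/\ continuous (Re_fct phi), continuous (Im_fct phi) &
      exists2 K : set 'rV[R]_n, compact K & forall x, ~ K x -> phi x = 0]].

Definition convolution f phi : fct := fun x =>
  let h := fun y => f (x - y) * phi y in
  Complex (\int[mu]_y Re_fct h y)%R (\int[mu]_y Im_fct h y)%R.

(* A Banach space of classes of functions modulo a.e. equality is given by the
   set E of all representatives of its elements, together with the norm N of
   the class of a function; N is irrelevant outside E. *)
Record banach_function_space E N : Prop := BanachFunctionSpace {
  bfs_L1loc : E `<=` L1loc ;
  bfs_ae : forall f g, E f -> L1loc g -> {ae mu, forall x, f x = g x} ->
    E g /\ N g = N f ;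
  bfs_0 : E (fun=> 0) ;
  bfs_add : forall f g, E f -> E g ->
    E (fun x => f x + g x) /\ N (fun x => f x + g x) <= N f + N g ;
  bfs_scale : forall (c : R[i]) f, E f ->
    E (fun x => c * f x) /\ N (fun x => c * f x) = normc c * N f ;
  bfs_norm_ge0 : forall f, E f -> 0 <= N f ;
  bfs_norm_eq0 : forall f, E f -> N f = 0 -> {ae mu, forall x, f x = 0} ;
  bfs_complete : forall u : nat -> fct, (forall k, E (u k)) ->
    (forall e : R, 0 < e -> exists k0, forall k l, (k0 <= k)%N -> (k0 <= l)%N ->
      N (fun x => u k x - u l x) < e) ->
    exists2 f, E f & N (fun x => u k x - f x) @[k --> \oo] --> 0 ;
  bfs_nontrivial : exists2 f, E f & ~ {ae mu, forall x, f x = 0} ;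
  (* continuity of the linear inclusion into the Frechet space L1loc, whose
     topology is given by the seminorms f |-> \int_K |f|, K compact *)
  bfs_continuous : forall K : set 'rV[R]_n, compact K ->
    exists C : R, forall f, E f ->
      (\int[mu]_(x in K) (normc (f x))%:E <= (C * N f)%:E)%E
}.

Record TIBF_bounded_type E N : Prop := TIBFBoundedType {
  tibf_bfs : banach_function_space E N ;
  tibf_translate : forall x f, E f -> E (translate x f) ;
  tibf_bounded : exists2 C0 : R, 0 < C0 &
    forall x f, E f -> N (translate x f) <= C0 * N f ;
  tibf_convolution : forall f phi, E f -> Cc phi -> E (convolution f phi)
}.

Definition solid E N : Prop := forall f g, E f -> L1loc g ->
  {ae mu, forall x, normc (g x) <= normc (f x)} -> E g /\ N g <= N f.

Local Notation mindex := {ffun 'I_n -> nat}.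

Definition morder (a : mindex) : nat := \sum_i a i.
Definition madd (a b : mindex) : mindex := [ffun i => (a i + b i)%N].

Definition partial (i : 'I_n) (g : 'rV[R]_n -> R) : 'rV[R]_n -> R :=
  fun x => 'D_(delta_mx ord0 i) g x.

Definition smooth_real (g : 'rV[R]_n -> R) : Prop := forall s : seq 'I_n,
  continuous (foldr partial g s) /\
  forall i x, derivable (foldr partial g s) x (delta_mx ord0 i).

(* the order of the partial derivatives is immaterial on smooth functions *)
Definition mderiv_real (a : mindex) (g : 'rV[R]_n -> R) : 'rV[R]_n -> R :=
  foldr (fun i h => iter (a i) (partial i) h) g (enum 'I_n).

Definition smooth f : Prop := smooth_real (Re_fct f) /\ smooth_real (Im_fct f).

Definition mderiv (a : mindex) f : fct := fun x =>
  Complex (mderiv_real a (Re_fct f) x) (mderiv_real a (Im_fct f) x).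

Definition rV_norm2 (x : 'rV[R]_n) : R := Num.sqrt (\sum_i x ord0 i ^+ 2).
Definition unit_ball : set 'rV[R]_n := [set x | rV_norm2 x < 1].

Definition weight_function (w : 'rV[R]_n -> R) : Prop :=
  continuous w /\ forall x, 1 <= w x.

Definition weight_function_system (W : {posnum R} -> 'rV[R]_n -> R) : Prop :=
  (forall l, weight_function (W l)) /\
  forall l m : {posnum R}, m%:num <= l%:num -> forall x, W l x <= W m x.

Definition weight_sequence (M : mindex -> R) : Prop :=
  [/\ forall a, 0 < M a, M [ffun=> 0%N] = 1 &
      forall A : R, exists k, forall a, (k <= morder a)%N ->
        A <= M a `^ (morder a)%:R^-1].

Definition weight_sequence_system (M : {posnum R} -> mindex -> R) : Prop :=
  (forall l, weight_sequence (M l)) /\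
  forall l m : {posnum R}, l%:num <= m%:num -> forall a, M l a <= M m a.

Definition mul_weight f (w : 'rV[R]_n -> R) : fct :=
  fun x => f x * real_complex R (w x).

Definition EMw_norm N (M : mindex -> R) (w : 'rV[R]_n -> R) f : \bar R :=
  ereal_sup [set (N (mul_weight (mderiv a f) w) / M a)%:E | a in [set: mindex]].

Definition EMw E N (M : mindex -> R) (w : 'rV[R]_n -> R) : set fct := [set f |
  [/\ smooth f, forall a, E (mul_weight (mderiv a f) w) &
      (EMw_norm N M w f < +oo)%E]].

End function_spaces.

Variant bracket := Beurling | Roumieu.

Section conditions.
Context (R : realType) (n : nat) (b : bracket).

Local Notation mindex := {ffun 'I_n -> nat}.
Local Notation wfs := ({posnum R} -> 'rV[R]_n -> R).
Local Notation wss := ({posnum R} -> mindex -> R).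
Implicit Types (W V : wfs) (M : wss).

(* The condition [P]: forall l, exists m, P l m in the Beurling case and
   forall m, exists l, P l m in the Roumieu case. *)
Definition quant2 (P : {posnum R} -> {posnum R} -> Prop) : Prop :=
  match b with
  | Beurling => forall l, exists m, P l m
  | Roumieu => forall m, exists l, P l m
  end.

Definition cond_wM W : Prop := quant2 (fun l m =>
  exists2 C : R, 0 < C &
  forall x y, unit_ball y -> W l (x + y) <= C * W m x).

Definition cond_M W : Prop :=
  let P l m p := exists2 C : R, 0 < C &
    forall x y, W l (x + y) <= C * W m x * W p y in
  match b with
  | Beurling => forall l, exists m p, P l m p
  | Roumieu => forall m p, exists l, P l m p
  end.

Definition wfs_incl W V : Prop := quant2 (fun l m =>
  exists2 C : R, 0 < C & forall t, V l t <= C * W m t).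

Definition cond_L M : Prop := forall r : R, 0 < r -> quant2 (fun l m =>
  exists2 C : R, 0 < C & forall a, r ^+ morder a * M m a <= C * M l a).

Definition cond_wI M : Prop := quant2 (fun l m =>
  exists2 H : R, 0 < H & forall r : R, 0 < r ->
  exists2 C : R, 0 < C & forall a c,
  M m a * r ^+ morder c <= C * H ^+ morder (madd a c) * M l (madd a c)).

Definition GS_space (E : set ('rV[R]_n -> R[i])) (N : ('rV[R]_n -> R[i]) -> R)
    M W : set ('rV[R]_n -> R[i]) :=
  match b with
  | Beurling => \bigcap_(l in [set: {posnum R}]) EMw E N (M l) (W l)
  | Roumieu => \bigcup_(l in [set: {posnum R}]) EMw E N (M l) (W l)
  end.

End conditions.

(* Main.v *)
Require Import Defs.
From mathcomp Require Import all_boot all_order all_algebra complex.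
From mathcomp Require Import all_classical all_reals all_analysis.
From mathcomp Require Import measurable_realfun ring lra.

Import Order.TTheory GRing.Theory Num.Theory.
Import numFieldNormedType.Exports.

Local Open Scope classical_set_scope.
Local Open Scope ring_scope.

(** Let phi be a nonzero element of the source space and suppose that the
    domination of V by W fails, so that v / w is unbounded for the weights w of W
    and v of V on which the quantifiers settle.  One could make the inclusion of
    sets continuous by a closed graph theorem and test the resulting norm
    inequality on the translates of phi.  Here the closed graph theorem is
    replaced by a gliding hump, so that one series of translates already
    contradicts the inclusion: choose centres x_j and coefficients c_j and put

      f = sum_j c_j phi(. - (x_j - a)),   where phi(a) <> 0.

    - By [M], translating phi to x costs at most a factor w(x) in the weighted
      norms, and E is solid with uniformly bounded translations
      (translate_weight_bound).  Hence f belongs to the source space as soon as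
      sum_j |c_j| w(x_j) converges (cseries_EMw).
    - Since w fails to dominate v, the points x_j can be chosen one after the
      other so that |c_j| w(x_j) <= 2^-j and yet |f(x_k)| v(x_k) is unbounded
      (gliding_hump): every later term is made negligible at the earlier
      points, and the sign of c_k prevents cancellation with the earlier terms.
    - By hypothesis f lies in the target space.  A Sobolev inequality on small
      cubes, together with the continuity of E -> L^1_loc and with [wM], turns
      membership in the target space into boundedness of |f| v
      (weighted_sup_bound, pointwise_decay), a contradiction.

    The Sobolev inequality has a second use: it bounds every derivative of phi
    on the whole of R^n, so that the series and all its termwise derivatives
    converge uniformly and f is smooth (smooth_real_tseries).  That f belongs to
    E with the expected norm then comes from completeness (bfs_series).  As the
    norms see only one order of differentiation for each multi-index, while
    smoothness speaks of all orders, the symmetry of second derivatives is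
    needed as well (partialC).

    The two readings of [.] differ only in which parameter varies along the
    hump: in the Beurling case the source weights w^(1/(j+1)) grow with j, so
    that f lies in every step of the projective limit; in the Roumieu case the
    target weights v^(j+1) decrease with j, so that f escapes every step of the
    inductive limit. *)

Set Implicit Arguments.
Unset Strict Implicit.
Unset Printing Implicit Defensive.

(** * Directional derivatives and smooth functions *)

Lemma dist_le_half {R : realFieldType} (p q r eps : R) :
  `|p - r| < eps / 2 -> `|q - r| < eps / 2 -> `|p - q| <= eps.
Proof.
move=> pr qr; rewrite -(subrKA r) (le_trans (ler_normD _ _))//.
by rewrite (splitr eps) lerD ?ltW// distrC.
Qed.

Section directional.
Context {R : realType}.

(** Translations, slices and lines are all maps A carrying the direction v to
    the direction u; the difference quotients of g \o A and g then agree, and with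
    them the derivatives. *)
Lemma growth_affine (V U : normedModType R) (A : V -> U) (v : V) (u : U)
    (g : U -> R) (x : V) :
  (forall (h : R) y, A (h *: v + y) = h *: u + A y) ->
  (fun h : R => h^-1 *: (((g \o A) \o shift x) (h *: v) - (g \o A) x)) =
  (fun h : R => h^-1 *: ((g \o shift (A x)) (h *: u) - g (A x))).
Proof. by move=> hA; apply/funext => h /=; rewrite hA. Qed.

Lemma derive_affine (V U : normedModType R) (A : V -> U) (v : V) (u : U)
    (g : U -> R) (x : V) :
  (forall (h : R) y, A (h *: v + y) = h *: u + A y) ->
  'D_v (g \o A) x = 'D_u g (A x).
Proof. by move=> hA; rewrite /derive (growth_affine g x hA). Qed.

Lemma derivable_affine (V U : normedModType R) (A : V -> U) (v : V) (u : U)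
    (g : U -> R) (x : V) :
  (forall (h : R) y, A (h *: v + y) = h *: u + A y) ->
  derivable g (A x) u -> derivable (g \o A) x v.
Proof. by move=> hA; rewrite /derivable (growth_affine g x hA). Qed.

Lemma is_derive_line (U : normedModType R) (e : U) (g : U -> R) (x : U) (t : R) :
  (forall y, derivable g y e) ->
  is_derive t 1 (fun s : R => g (x + s *: e)) ('D_e g (x + t *: e)).
Proof.
move=> dg; have hA (h y : R) : x + (h *: (1 : R^o) + y) *: e = h *: e + (x + y *: e).
  by rewrite scalerDl addrCA [h *: 1]mulr1.
apply: DeriveDef; first exact: (derivable_affine (V := R^o) hA).
exact: (derive_affine (V := R^o) g t hA).
Qed.

Lemma line_mean_value (U : normedModType R) (e : U) (g : U -> R) (x : U) (h : R) :
  (forall y, derivable g y e) ->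
  exists2 c, `|c| <= `|h| & g (x + h *: e) - g x = h * 'D_e g (x + c *: e).
Proof.
move=> dg.
have cont (a b : R) : {within `[a, b], continuous (fun s : R => g (x + s *: e))}.
  apply: continuous_subspaceT => s; apply: differentiable_continuous.
  by apply/derivable1_diffP; have := is_derive_line x s dg; case.
have [h0|h0] := leP 0 h.
  have [c + /=] := MVT_segment h0 (fun t _ => is_derive_line x t dg) (cont _ _).
  rewrite in_itv /= scale0r addr0 subr0 => /andP[c0 ch] ->.
  by exists c; [rewrite !ger0_norm | rewrite mulrC].
have [c + /=] := MVT_segment (ltW h0) (fun t _ => is_derive_line x t dg) (cont _ _).
rewrite in_itv /= scale0r addr0 sub0r => /andP[ch c0] E.
exists c; first by rewrite !ler0_norm ?lerN2// ltW.
by apply: oppr_inj; rewrite opprB E mulrN mulrC.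
Qed.

Lemma line_lipschitz (U : normedModType R) (e : U) (g : U -> R) (B : R) (x : U)
    (h : R) :
  (forall y, derivable g y e) -> (forall y, `|'D_e g y| <= B) ->
  `|g (x + h *: e) - g x| <= B * `|h|.
Proof.
move=> dg hB; have [c _ ->] := line_mean_value x h dg.
by rewrite normrM mulrC ler_wpM2r.
Qed.

(** A bound on the second derivative makes the error quadratic in h, uniformly
    in x, which is what allows a series to be differentiated termwise. *)
Lemma line_taylor (U : normedModType R) (e : U) (g : U -> R) (B : R) (x : U)
    (h : R) :
  (forall y, derivable g y e) -> (forall y, derivable ('D_e g) y e) ->
  (forall y, `|'D_e ('D_e g) y| <= B) ->
  `|g (x + h *: e) - g x - h * 'D_e g x| <= B * `|h| ^+ 2.
Proof.
move=> dg ddg hB; have [c ch ->] := line_mean_value x h dg.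
rewrite -mulrBr normrM expr2 mulrA mulrC ler_wpM2r//.
apply: le_trans (line_lipschitz x c ddg hB) _.
by rewrite ler_wpM2l// (le_trans _ (hB x)).
Qed.

End directional.

Section smooth_functions.
Context {R : realType} {n : nat}.
Implicit Types (g : 'rV[R]_n -> R) (s t : seq 'I_n).
Local Notation e := (fun i : 'I_n => (delta_mx ord0 i : 'rV[R]_n)).

Lemma smooth_real_foldr g s : smooth_real g -> smooth_real (foldr (@partial R n) g s).
Proof. by move=> sg t; rewrite -foldr_cat; exact: sg. Qed.

Lemma smooth_real_partial g i : smooth_real g -> smooth_real (partial i g).
Proof. exact: (@smooth_real_foldr g [:: i]). Qed.

Lemma smooth_real_continuous g : smooth_real g -> continuous g.
Proof. by move=> sg; have [] := sg [::]. Qed.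

Lemma smooth_real_derivable g : smooth_real g -> forall i x, derivable g x (e i).
Proof. by move=> sg; have [] := sg [::]. Qed.

(** The mean value theorem applied first in the direction e i to
    y |-> g (y + k e j) - g y, then in the direction e j to partial i g. *)
Lemma second_difference g i j x (h k : R) : smooth_real g ->
  exists c d, [/\ `|c| <= `|h|, `|d| <= `|k| &
    g (x + h *: e i + k *: e j) - g (x + h *: e i) - (g (x + k *: e j) - g x) =
    h * k * partial j (partial i g) (x + c *: e i + d *: e j)].
Proof.
move=> sg.
have sh (y : 'rV[R]_n) l (a : R) z : a *: e l + z + y = a *: e l + (z + y).
  by rewrite addrA.
pose G y := g (y + k *: e j) - g y.
have dG y : derivable G y (e i).
  apply: derivableB; last exact: smooth_real_derivable.
  by apply: (derivable_affine (sh (k *: e j) i)); exact: smooth_real_derivable.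
have [c ch Gc] := line_mean_value x h dG.
have DG y : 'D_(e i) G y = partial i g (y + k *: e j) - partial i g y.
  rewrite deriveB; last 2 first.
  - by apply: (derivable_affine (sh (k *: e j) i)); exact: smooth_real_derivable.
  - exact: smooth_real_derivable.
  by congr (_ - _); exact: (derive_affine g _ (sh (k *: e j) i)).
have dpg y : derivable (partial i g) y (e j).
  by apply: smooth_real_derivable; exact: smooth_real_partial.
have [d dk Gd] := line_mean_value (x + c *: e i) k dpg.
by exists c, d; split => //; rewrite -mulrA -Gd -DG -Gc.
Qed.

(** Schwarz: the second difference is symmetric in i and j, and divided by h^2
    it is close to either mixed derivative, by continuity. *)
Lemma partialC g i j : smooth_real g -> partial i (partial j g) = partial j (partial i g).
Proof.
move=> sg; apply/funext => x.
have lim l m : forall eps : R, 0 < eps -> exists2 r : R, 0 < r &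
    forall c d : R, `|c| <= r -> `|d| <= r ->
    `|partial l (partial m g) x - partial l (partial m g) (x + c *: e m + d *: e l)| < eps.
  move=> eps eps0.
  have cg : continuous (partial l (partial m g)).
    by apply: smooth_real_continuous; do 2! apply: smooth_real_partial.
  have := cg x; move=> /cvgr_dist_lt /(_ eps eps0).
  rewrite -nbhs_nearE => /nbhs_ballP[r /= r0 hr].
  have P0 : 0 < `|e m| + `|e l| + 1 by rewrite ltr_pwDr.
  exists (r / (`|e m| + `|e l| + 1)); first by rewrite divr_gt0.
  move=> c d cr dr; apply: hr; rewrite -ball_normE /=.
  rewrite -addrA opprD addNKr normrN (le_lt_trans (ler_normD _ _))// !normrZ.
  rewrite (@le_lt_trans _ _ (r / (`|e m| + `|e l| + 1) * (`|e m| + `|e l|)))//.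
    by rewrite mulrDr lerD// ler_wpM2r.
  by rewrite mulrAC ltr_pdivrMr// ltr_pM2l// ltrDl.
apply/eqP; rewrite -subr_eq0 -normr_eq0 eq_le normr_ge0 andbT.
apply/ler_addgt0Pl => eps eps0; rewrite addr0.
have e20 : 0 < eps / 2 by rewrite divr_gt0.
have [r1 r10 h1] := lim i j _ e20; have [r2 r20 h2] := lim j i _ e20.
pose h := Num.min r1 r2.
have h0 : 0 < h by rewrite lt_min r10.
have [c [d [ch dh E]]] := second_difference j i x h h sg.
have [c' [d' [ch' dh' E']]] := second_difference i j x h h sg.
have EE : partial i (partial j g) (x + c *: e j + d *: e i) =
          partial j (partial i g) (x + c' *: e i + d' *: e j).
  have hh0 : h * h != 0 by exact: lt0r_neq0 (mulr_gt0 h0 h0).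
  have swap (p q r s : R) : p - q - (r - s) = p - r - (q - s) by ring.
  apply: (mulfI hh0); apply: (etrans (esym E)); apply: (etrans _ E').
  by rewrite swap [x + h *: e i + _]addrAC.
have lr (z : R) : `|z| <= `|h| -> `|z| <= r1 /\ `|z| <= r2.
  by rewrite (gtr0_norm h0) /h le_min => /andP.
have [? ?] := lr _ ch; have [? ?] := lr _ dh.
have [? ?] := lr _ ch'; have [? ?] := lr _ dh'.
have H1 : `|partial i (partial j g) x -
    partial i (partial j g) (x + c *: e j + d *: e i)| < eps / 2 by exact: h1.
have H2 : `|partial j (partial i g) x -
    partial j (partial i g) (x + c' *: e i + d' *: e j)| < eps / 2 by exact: h2.
rewrite EE in H1; exact: dist_le_half H1 H2.
Qed.

Lemma foldr_partial_rem g i s : smooth_real g -> i \in s ->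
  foldr (@partial R n) g s = partial i (foldr (@partial R n) g (rem i s)).
Proof.
move=> sg; elim: s => //= j s IH; rewrite inE eq_sym.
case: eqP => [->//|_ /= /IH ->] /=.
by rewrite partialC//; exact: smooth_real_foldr.
Qed.

Lemma foldr_partial_perm g s t : smooth_real g -> perm_eq s t ->
  foldr (@partial R n) g s = foldr (@partial R n) g t.
Proof.
move=> sg; elim: s t => [|i s IH] t.
  by move=> /perm_size /=; case: t.
move=> st; have it : i \in t by rewrite -(perm_mem st) mem_head.
rewrite (foldr_partial_rem sg it) /= (IH (rem i t))//.
by rewrite -(perm_cons i) (permPl st); exact: perm_to_rem.
Qed.

Lemma foldr_partial_shift g (x : 'rV[R]_n) s :
  foldr (@partial R n) (fun y => g (y + x)) s =
  (fun y => foldr (@partial R n) g s (y + x)).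
Proof.
elim: s => //= i s ->; apply/funext => y.
by apply: (derive_affine (A := fun y => y + x)) => h z; rewrite addrA.
Qed.

Lemma continuous_shift g (y : 'rV[R]_n) :
  continuous g -> continuous (fun x : 'rV[R]_n => g (x + y)).
Proof.
move=> cg x.
apply: (@continuous_comp _ _ _ (fun x : 'rV[R]_n => x + y) g); last exact: cg.
apply: (@continuousD R 'rV[R]_n _ id (cst y)) => [A //|]; exact: cst_continuous.
Qed.

Lemma smooth_real_shift g (x : 'rV[R]_n) :
  smooth_real g -> smooth_real (fun y => g (y + x)).
Proof.
move=> sg s; rewrite foldr_partial_shift; have [cg dg] := sg s; split=> [|i y].
  exact: continuous_shift.
apply: (derivable_affine (A := fun y => y + x)); last exact: dg.
by move=> h z; rewrite addrA.
Qed.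

Definition mindex_seq (a : {ffun 'I_n -> nat}) : seq 'I_n :=
  flatten [seq nseq (a i) i | i <- enum 'I_n].

Lemma mderiv_realE a g : mderiv_real a g = foldr (@partial R n) g (mindex_seq a).
Proof.
rewrite /mderiv_real /mindex_seq; elim: (enum 'I_n) => //= i s ->.
by rewrite foldr_cat; elim: (a i) => //= k ->.
Qed.

(** Norms control only the derivatives mderiv_real a; this reduces a derivative
    taken in any order of the directions to one of them. *)
Lemma foldr_partial_mderiv s : exists a : {ffun 'I_n -> nat},
  forall g, smooth_real g -> foldr (@partial R n) g s = mderiv_real a g.
Proof.
exists [ffun i => count_mem i s] => g sg; rewrite mderiv_realE.
apply: foldr_partial_perm => //; apply/allP => i _ /=; apply/eqP.
rewrite /mindex_seq count_flatten -map_comp.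
rewrite (eq_map (g := fun j => (j == i) * count_mem i s)%N); last first.
  by move=> j /=; rewrite count_nseq ffunE /=; case: eqP => // ->; rewrite !mul1n.
rewrite sumnE big_map big_enum /= (bigD1 i)//= eqxx mul1n big1 ?addn0//.
by move=> j /negbTE ->.
Qed.

End smooth_functions.

(** * Borel sets of R^n *)

Section borel.
Context {R : realType} {n : nat}.
Local Notation mu := (lebesgue_rV R n).

Lemma measurable_box (A : 'I_n -> set R) : (forall i, measurable (A i)) ->
  measurable [set v : 'rV[R]_n | forall i, A i (v ord0 i)].
Proof.
move=> mA; have -> : [set v : 'rV[R]_n | forall i, A i (v ord0 i)] =
    \bigcap_(i in [set: 'I_n]) [set v | A i (v ord0 i)].
  by apply/seteqP; split=> v /= Av i => [_|]; exact: Av.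
apply: fin_bigcap_measurable => // i _.
by have := @measurable_coord R n i measurableT (A i) (mA i); rewrite setTI.
Qed.

(** The sigma-algebra of R^n is generated by the coordinates; an open set is the
    countable union of the boxes with rational centre and side 1/(k+1) inside it. *)
Lemma open_measurable_rV (U : set 'rV[R]_n) : open U -> measurable U.
Proof.
move=> oU.
pose c (q : 'rV[rat]_n) : 'rV[R]_n := \row_i ratr (q ord0 i).
pose B (p : 'rV[rat]_n * nat) : set 'rV[R]_n :=
  [set v | forall i, ball (c p.1 ord0 i) p.2.+1%:R^-1 (v ord0 i)].
have mB p : measurable (B p).
  apply: (@measurable_box (fun i => ball (c p.1 ord0 i) p.2.+1%:R^-1)) => i.
  exact: measurable_ball.
pose F k : set 'rV[R]_n := if @unpickle ('rV[rat]_n * nat)%type k is Some p then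
  (if pselect (B p `<=` U) then B p else set0) else set0.
have -> : U = \bigcup_k F k.
  apply/seteqP; split; last first.
    by move=> v [k _]; rewrite /F; case: unpickle => [p|//]; case: pselect => [BU /BU|].
  move=> v Uv; have /nbhs_ballP[r /= r0 hr] : nbhs v U by apply: open_nbhs_nbhs.
  have [k /= kr] : exists k, k.+1%:R^-1 < r / 2.
    have r20 : 0 < r / 2 by rewrite divr_gt0.
    have [k _ /(_ k (leqnn _)) /=] := near_infty_natSinv_lt (PosNum r20).
    by exists k.
  have k0 : 0 < k.+1%:R^-1 :> R by rewrite invr_gt0.
  have /choice[q hq] : forall i : 'I_n, exists q : rat,
      ball (ratr q : R) k.+1%:R^-1 (v ord0 i).
    move=> i; have [q] := @rat_in_itvoo R (v ord0 i - k.+1%:R^-1) (v ord0 i + k.+1%:R^-1)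
      ltac:(by rewrite ltrBlDr -addrA ltrDl addr_gt0).
    by rewrite in_itv /= => hq; exists q; rewrite -ball_normE /= ltr_distl.
  exists (pickle ((\row_i q i : 'rV[rat]_n), k)) => //.
  rewrite /F pickleK; case: pselect => [BU|nB].
    by move=> i; rewrite /c !mxE; exact: hq.
  exfalso; apply: nB => u Bu; apply: hr; split => // a i.
  have -> : a = ord0 by exact: ord1.
  have := Bu i; have := hq i; rewrite /c /= !mxE -!ball_normE /= => H1 H2.
  rewrite -(subrKA (ratr (q i))) (le_lt_trans (ler_normD _ _))// distrC.
  by rewrite (lt_le_trans (ltrD H1 H2))// [leRHS]splitr lerD// ltW.
apply: bigcupT_measurable => k; rewrite /F; case: unpickle => [p|//].
case: pselect => [BU|nBU]; [exact: mB|exact: measurable0].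
Qed.

Lemma compact_measurable_rV (K : set 'rV[R]_n) : compact K -> measurable K.
Proof.
move=> /compact_closed => /(_ (@norm_hausdorff _ _)) /closed_openC /open_measurable_rV.
by move=> /measurableC; rewrite setCK.
Qed.

Lemma continuous_measurable_rV (g : 'rV[R]_n -> R) :
  continuous g -> measurable_fun setT g.
Proof.
move=> /continuousP cg; apply: (measurability _ (RGenOpens.measurableE R)).
move=> _ [_ [a [b ->] <-]]; rewrite setTI; apply: open_measurable_rV.
exact/cg/interval_open.
Qed.

Lemma compact_lebesgue_lty (K : set 'rV[R]_n) : compact K -> (mu K < +oo)%E.
Proof.
move=> cK; have [M [Mr hM]] := compact_bounded cK.
pose r := Num.max M 0 + 1.
have r0 : 0 < r by rewrite ltr_pwDr// le_max lexx orbT.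
have Kr v : K v -> forall i, v ord0 i \in `[- r, r].
  move=> Kv i; have : `|v| <= r.
    by apply: hM => //; rewrite ltr_pwDr// le_max lexx.
  rewrite in_itv /= -ler_norml => /(le_trans _); apply.
  rewrite [leRHS]mx_normrE.
  exact: (le_bigmax _ (fun ij : 'I_1 * 'I_n => `|v ij.1 ij.2|) (ord0, i)).
apply: (@le_lt_trans _ _ (mu [set v | forall i, `[- r, r]%classic (v ord0 i)])).
  apply: le_measure; rewrite ?inE//; first exact: compact_measurable_rV.
    by apply: (@measurable_box (fun=> `[- r, r]%classic)) => i; exact: measurable_itv.
rewrite (@lebesgue_rV_box R n (fun=> `[- r, r]%classic)); last first.
  by move=> i; exact: measurable_itv.
rewrite ltey_eq; apply/orP; left; elim/big_ind: _ => // [x y|i _].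
  exact: fin_numM.
by rewrite lebesgue_measure_itv /= lte_fin ifT ?gtrN// -EFinD.
Qed.

End borel.

(** * A Sobolev inequality on cubes *)

Section sobolev_line.
Context {R : realType}.
Local Notation leb := (@lebesgue_measure R).
Local Open Scope ereal_scope.

(** The fundamental theorem of calculus on [0, t], enlarged to [0, d]. *)
Lemma abs_ftc (f df : R -> R) (d t : R) :
  (forall x : R, is_derive x (1%R : R) f (df x)) -> continuous df ->
  (0 <= t <= d)%R ->
  `|f 0%R|%:E <= `|f t|%:E + \int[leb]_(x in `[0%R, d]) `|df x|%:E.
Proof.
move=> hf cdf /andP[t0 td].
have cf : continuous f.
  by move=> x; apply/differentiable_continuous/derivable1_diffP; have [] := hf x.
have mdf : measurable_fun [set: R] df by exact: continuous_measurable_fun.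
have mabs D : measurable D -> measurable_fun D (fun x => `|df x|%:E).
  move=> mD; apply/measurable_EFinP; apply: (@measurable_funTS _ _ _ _ D).
  exact: measurableT_comp.
have I0 D : 0 <= \int[leb]_(x in D) `|df x|%:E by apply: integral_ge0 => x _; rewrite lee_fin.
move: t0; rewrite le_eqVlt => /predU1P[<-|t0]; first by rewrite leeDl.
have ftc : \int[leb]_(x in `[0%R, t]) (df x)%:E = (f t)%:E - (f 0%R)%:E.
  apply: continuous_FTC2 => //.
  - exact: continuous_subspaceT.
  - split.
    + by move=> x _; have [] := hf x.
    + exact/cvg_at_right_filter/cf.
    + exact/cvg_at_left_filter/cf.
  - by move=> x _; rewrite derive1E; have [] := hf x.
have le1 : `|f t - f 0%R|%:E <= \int[leb]_(x in `[0%R, d]) `|df x|%:E.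
  rewrite -abse_EFin EFinB -ftc; apply: le_trans (le_abse_integral _ _ _) _ => //.
    by apply/measurable_EFinP; apply: measurable_funTS.
  apply: ge0_subset_integral => //.
  - exact: mabs.
  - by apply: subset_itvl; rewrite bnd_simp.
apply: (@le_trans _ _ (`|f t|%:E + `|f t - f 0%R|%:E)).
  rewrite -EFinD lee_fin -{1}(subKr (f t) (f 0%R)).
  by rewrite (le_trans (ler_normB _ _)).
exact: leeD2l.
Qed.

(** Averaging abs_ftc over t in [0, d]. *)
Lemma sobolev_line (f df : R -> R) (d : R) : (0 < d)%R ->
  (forall x : R, is_derive x (1%R : R) f (df x)) -> continuous df ->
  d%:E * `|f 0%R|%:E <= \int[leb]_(x in `[0%R, d]) `|f x|%:E +
    d%:E * \int[leb]_(x in `[0%R, d]) `|df x|%:E.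
Proof.
move=> d0 hf cdf; set I := \int[leb]_(x in `[0%R, d]) `|df x|%:E.
have cf : continuous f.
  by move=> x; apply/differentiable_continuous/derivable1_diffP; have [] := hf x.
have lebd : leb `[0%R, d]%classic = d%:E.
  by rewrite lebesgue_measure_itv /= lte_fin d0 oppr0 adde0.
have I0 : 0 <= I by apply: integral_ge0 => x _; rewrite lee_fin.
rewrite muleC [X in _ + X]muleC -lebd.
rewrite -(integral_cst leb _ `|f 0%R|%:E)//.
rewrite -(integral_cst leb _ I)//.
have mf : measurable_fun `[0%R, d]%classic (fun x => `|f x|%:E).
  apply/measurable_EFinP; apply: measurable_funTS.
  by apply: measurableT_comp => //; exact: continuous_measurable_fun.
rewrite -ge0_integralD//.
apply: ge0_le_integral => //.
- by move=> x _; rewrite lee_fin.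
- exact: emeasurable_funD.
- by move=> x; rewrite /= in_itv /=; exact: abs_ftc.
Qed.

End sobolev_line.

Section slices.
Context {R : realType} {n : nat}.
Local Notation e i := (delta_mx ord0 i).
Implicit Types (g : 'rV[R]_n.+1 -> R) (t : R).

Definition slice t g : 'rV[R]_n -> R := fun y => g (cons_rV (t, y)).

Lemma row_ord0P m (u v : 'rV[R]_m) : (forall k, u ord0 k = v ord0 k) -> u = v.
Proof. by move=> uv; apply/rowP => k; exact: uv. Qed.

(** unliftP with the index in 'I_n instead of 'I_(n.+1).-1. *)
Lemma ord_consP (k : 'I_n.+1) : k = ord0 \/ exists j : 'I_n, k = lift ord0 j.
Proof. by have [j ->|->] := unliftP ord0 k; [right; exists j|left]. Qed.

Lemma cons_rV_head t (y : 'rV[R]_n) : cons_rV (t, y) ord0 ord0 = t.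
Proof. exact: cons_rV0. Qed.

Lemma cons_rV_tail t (y : 'rV[R]_n) i : cons_rV (t, y) ord0 (lift ord0 i) = y ord0 i.
Proof. exact: cons_rVS. Qed.

Lemma cons_rV_line t h i (y : 'rV[R]_n) :
  cons_rV (t, h *: e i + y) = h *: e (lift ord0 i) + cons_rV (t, y).
Proof.
apply: row_ord0P => k; have [->|[j ->]] := ord_consP k; last first.
  by rewrite [RHS]mxE !cons_rV_tail !mxE (inj_eq lift_inj).
by rewrite [RHS]mxE !cons_rV_head !mxE /= mulr0 add0r.
Qed.

Lemma cons_rV_axis t : cons_rV (t, 0 : 'rV[R]_n) = t *: e ord0.
Proof.
apply: row_ord0P => k; have [->|[j ->]] := ord_consP k; last first.
  by rewrite cons_rV_tail !mxE /= mulr0.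
by rewrite cons_rV_head !mxE /= mulr1.
Qed.

Lemma foldr_partial_slice t g s :
  foldr (@partial R n) (slice t g) s =
  slice t (foldr (@partial R n.+1) g (map (lift ord0) s)).
Proof.
elim: s => //= i s ->; apply/funext => y.
exact: (derive_affine _ _ (fun h => cons_rV_line t h i)).
Qed.

Lemma continuous_cons_rV t : continuous (fun y : 'rV[R]_n => cons_rV (t, y)).
Proof.
move=> y A /nbhs_ballP[r /= r0 hr]; apply/nbhs_ballP; exists r => //= z [_ yz].
apply: hr; split=> // a k; have -> : a = ord0 by exact: ord1.
have [->|[j ->]] := ord_consP k; last by rewrite !cons_rV_tail.
by rewrite !cons_rV_head; exact: ballxx.
Qed.

Lemma smooth_real_slice t g : smooth_real g -> smooth_real (slice t g).
Proof.
move=> sg s; rewrite foldr_partial_slice; have [cg dg] := sg (map (lift ord0) s).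
split=> [y|i y].
  apply: (@continuous_comp _ _ _ (fun y => cons_rV (t, y))); last exact: cg.
  exact: continuous_cons_rV.
exact: (derivable_affine (fun h => cons_rV_line t h i)).
Qed.

End slices.

Section sobolev.
Context {R : realType} (d : R) (d0 : 0 < d).
Local Notation leb := (@lebesgue_measure R).

Definition cube n : set 'rV[R]_n := [set v | forall i, `[0, d]%classic (v ord0 i)].

Arguments cube : clear implicits.

Lemma compact_cube n : compact (cube n).
Proof.
by apply: (@rV_compact R n (fun=> `[0, d]%classic)) => i; exact: segment_compact.
Qed.

Lemma measurable_cube n : measurable (cube n).
Proof. by apply: compact_measurable_rV; exact: compact_cube. Qed.

Lemma cube_cons n t (y : 'rV[R]_n) : cube n.+1 (cons_rV (t, y)) <->
  `[0, d]%classic t /\ cube n y.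
Proof.
split=> [h|[h0 h] i].
  split=> [|i]; first by have := h ord0; rewrite cons_rV_head.
  by have := h (lift ord0 i); rewrite cons_rV_tail.
by have [->|[j ->]] := ord_consP i; rewrite ?cons_rV_tail ?cons_rV_head.
Qed.

Local Open Scope ereal_scope.

Lemma integral_mul_indic n (D : set 'rV[R]_n) (f : 'rV[R]_n -> \bar R) :
  \int[lebesgue_rV R n]_(v in D) f v =
  \int[lebesgue_rV R n]_v (f v * (\1_D v)%:E).
Proof.
rewrite integral_mkcond; apply: eq_integral => v _.
by rewrite patchE indicE; case: ifP => _; rewrite ?mule1 ?mule0.
Qed.

Lemma measurable_mul_indic_cube n (f : 'rV[R]_n -> \bar R) :
  measurable_fun setT f -> measurable_fun setT (fun v => f v * (\1_(cube n) v)%:E).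
Proof.
move=> mf; apply: emeasurable_funM => //; apply/measurable_EFinP.
by apply: measurable_indic; exact: measurable_cube.
Qed.

(** The indicator of the cube of dimension n.+1 splits into the indicator of the
    cube of dimension n and that of the interval [0, d]. *)
Lemma cube_slice n (f : 'rV[R]_n.+1 -> \bar R) (t : R) :
  \int[lebesgue_rV R n]_y
    (f (cons_rV (t, y)) * (\1_(cube n.+1) (cons_rV (t, y)))%:E) =
  (\int[lebesgue_rV R n]_(y in cube n) f (cons_rV (t, y))) *
    (\1_(`[0%R, d]%classic) t)%:E.
Proof.
rewrite [in RHS]indicE; have [td|td] := boolP (t \in _).
  rewrite mule1 [RHS]integral_mul_indic; apply: eq_integral => y _.
  rewrite !indicE; congr (_ * (_%:R)%:E); congr nat_of_bool.
  apply/idP/idP; rewrite !inE; first by move=> /cube_cons[].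
  by move=> yc; apply/cube_cons; split=> //; rewrite inE in td.
rewrite mule0 integral0_eq// => y _; rewrite indicE; case: (boolP (_ \in _)); last first.
  by rewrite mule0.
by rewrite inE => /cube_cons[td' _]; rewrite notin_setE in td.
Qed.

Lemma integral_cube_cons n (f : 'rV[R]_n.+1 -> \bar R) :
  measurable_fun setT f -> (forall v, 0 <= f v) ->
  \int[lebesgue_rV R n.+1]_(v in cube n.+1) f v =
  \int[leb]_(t in `[0%R, d]) \int[lebesgue_rV R n]_(y in cube n) f (cons_rV (t, y)).
Proof.
move=> mf f0; rewrite integral_mul_indic.
set F := fun v => f v * (\1_(cube n.+1) v)%:E.
have mF : measurable_fun setT F by exact: measurable_mul_indic_cube.
have F0 v : 0 <= F v by rewrite mule_ge0// lee_fin.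
transitivity (\int[(leb \x lebesgue_rV R n)%E]_p F (cons_rV p)).
  exact: (ge0_integral_pushforward (@measurable_cons_rV R n) _ measurableT mF).
rewrite fubini_tonelli1//; last exact: (measurableT_comp mF (@measurable_cons_rV R n)).
rewrite [RHS]integral_mkcond; apply: eq_integral => t _.
rewrite /fubini_F /F cube_slice patchE indicE.
by case: ifP => _; rewrite ?mule1 ?mule0.
Qed.

Lemma measurable_integral_cube n (f : 'rV[R]_n.+1 -> \bar R) :
  measurable_fun setT f -> (forall v, 0 <= f v) ->
  measurable_fun `[0%R, d]%classic (fun t : R =>
    \int[lebesgue_rV R n]_(y in cube n) f (cons_rV (t, y))).
Proof.
move=> mf f0.
pose F (p : measurableTypeR R * 'rV[R]_n) :=
  f (cons_rV p) * (\1_(cube n.+1) (cons_rV p))%:E.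
have mF : measurable_fun setT (fubini_F (lebesgue_rV R n) F).
  apply: measurable_fun_fubini_tonelli_F.
    exact: (measurableT_comp (measurable_mul_indic_cube mf) (@measurable_cons_rV R n)).
  by move=> p; rewrite mule_ge0// lee_fin.
apply: (eq_measurable_fun (fubini_F (lebesgue_rV R n) F)); last first.
  exact: measurable_funTS.
by move=> t td; rewrite /fubini_F cube_slice indicE td mule1.
Qed.

Lemma measurable_abs_smooth n (g : 'rV[R]_n -> R) s : smooth_real g ->
  measurable_fun setT (fun v => `|foldr (@partial R n) g s v|%:E).
Proof.
move=> sg; apply/measurable_EFinP; apply: measurableT_comp => //.
by apply: continuous_measurable_rV; have [] := sg s.
Qed.

(** By induction on the dimension: freeze the first coordinate t, apply the
    inequality in dimension n to the slices at t of h = g and h = partial ord0 g,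
    integrate over t in [0, d] by Tonelli, and conclude with sobolev_line on the
    first axis.  The list L consists of the mixed derivatives of order at most 1
    in each variable. *)
Lemma sobolev n : exists (L : seq (seq 'I_n)) (C : R), (0 <= C)%R /\
  forall g : 'rV[R]_n -> R, smooth_real g ->
  `|g 0%R|%:E <= C%:E * \sum_(s <- L)
    \int[lebesgue_rV R n]_(v in cube n) `|foldr (@partial R n) g s v|%:E.
Proof.
elim: n => [|n [L [C [C0 IH]]]].
  exists [:: [::]], 1%R; split=> // g sg; rewrite mul1e big_seq1 /=.
  rewrite integral_dirac; last 2 first.
  - exact: measurable_cube.
  - by apply: measurable_funTS; exact: (measurable_abs_smooth [::] sg).
  by rewrite diracE mem_set ?mul1e// => -[].
pose L1 := map (map (lift ord0)) L.
pose S (h : 'rV[R]_n.+1 -> R) := \sum_(s <- L1)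
  \int[lebesgue_rV R n.+1]_(v in cube n.+1) `|foldr (@partial R n.+1) h s v|%:E.
have step h : smooth_real h ->
    \int[leb]_(t in `[0%R, d]) `|h (cons_rV (t, 0%R))|%:E <= C%:E * S h.
  move=> sh.
  have mI s : measurable_fun `[0%R, d]%classic (fun t : R =>
      \int[lebesgue_rV R n]_(y in cube n) `|foldr (@partial R n.+1) h s (cons_rV (t, y))|%:E).
    apply: (@measurable_integral_cube n (fun v => `|foldr (@partial R n.+1) h s v|%:E)).
      exact: measurable_abs_smooth.
    by move=> v; rewrite lee_fin.
  have I0 s t : 0 <= \int[lebesgue_rV R n]_(y in cube n)
      `|foldr (@partial R n.+1) h s (cons_rV (t, y))|%:E.
    by apply: integral_ge0 => y _; rewrite lee_fin.
  rewrite /S; under eq_bigr do rewrite (integral_cube_cons (measurable_abs_smooth _ sh))//.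
  rewrite -ge0_integral_sum//.
  rewrite -ge0_integralZl_EFin//; last 2 first.
  - by move=> t _; exact: sume_ge0.
  - by apply: emeasurable_sum => s; exact: mI.
  apply: ge0_le_integral => //.
  - apply: measurable_funTS; apply/measurable_EFinP; apply: measurableT_comp => //.
    apply: continuous_measurable_fun.
    under eq_fun do rewrite cons_rV_axis.
    move=> t; apply: continuous_comp; first exact: scalel_continuous.
    exact: smooth_real_continuous.
  - by apply: emeasurable_funM => //; apply: emeasurable_sum => s; exact: mI.
  move=> t _; have := IH _ (smooth_real_slice t sh).
  by under eq_bigr do rewrite foldr_partial_slice; rewrite /L1 big_map.
exists (L1 ++ map (rcons^~ ord0) L1), (d^-1 * (C + d * C))%R.
have d0' : (0 <= d)%R by exact: ltW.
split; first by rewrite mulr_ge0 ?invr_ge0// addr_ge0// mulr_ge0.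
move=> g sg.
have S0 h : 0 <= S h.
  by apply: sume_ge0 => s _; apply: integral_ge0 => v _; rewrite lee_fin.
have cg : forall t : R, is_derive t (1%R : R) (fun s : R => g (cons_rV (s, 0%R)))
    (partial ord0 g (cons_rV (t, 0%R))).
  move=> t; under eq_fun do rewrite cons_rV_axis -[X in g X]add0r.
  rewrite cons_rV_axis -[X in partial _ _ X]add0r.
  by apply: is_derive_line => y; exact: smooth_real_derivable.
have cdg : continuous (fun t : R => partial ord0 g (cons_rV (t, 0%R))).
  under eq_fun do rewrite cons_rV_axis.
  move=> t; apply: continuous_comp; first exact: scalel_continuous.
  exact/smooth_real_continuous/smooth_real_partial.
have := sobolev_line d0 cg cdg.
have -> : cons_rV (0%R, 0%R) = 0%R :> 'rV[R]_n.+1 by rewrite cons_rV_axis scale0r.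
move=> H.
have {}H : d%:E * `|g 0%R|%:E <= (C + d * C)%:E * (S g + S (partial ord0 g)).
  apply: (le_trans H); rewrite (ge0_muleDr _ (S0 _) (S0 _)).
  apply: leeD.
    by apply: (le_trans (step _ sg)); rewrite lee_wpmul2r// lee_fin lerDl mulr_ge0.
  apply: le_trans (lee_wpmul2l _ (step _ (smooth_real_partial ord0 sg))) _.
    by rewrite lee_fin.
  by rewrite muleA lee_wpmul2r// lee_fin lerDr.
rewrite big_cat /= -/(S g) big_map.
have -> : \sum_(s <- L1) \int[lebesgue_rV R n.+1]_(v in cube n.+1)
   `|foldr (@partial R n.+1) g (rcons s ord0) v|%:E = S (partial ord0 g).
  by apply: eq_bigr => s _; under eq_integral do rewrite foldr_rcons.
by rewrite EFinM -muleA lee_pdivlMl.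
Qed.

End sobolev.
Arguments cube {R} d n.

(** * Pointwise bounds from the norm of E *)

Section modulus.
Context {R : realType}.
Local Notation normc := (@ComplexField.Normc.normc R).

Lemma normc_sqrt (z : R[i]) : normc z = Num.sqrt (complex.Re z ^+ 2 + complex.Im z ^+ 2).
Proof. by case: z. Qed.

Lemma normc_ge0 (z : R[i]) : 0 <= normc z.
Proof. by rewrite normc_sqrt sqrtr_ge0. Qed.

Lemma normc_ge_ReIm (z : R[i]) : `|complex.Re z| <= normc z /\ `|complex.Im z| <= normc z.
Proof.
rewrite normc_sqrt -2!sqrtr_sqr; split; rewrite ler_sqrt ?addr_ge0 ?sqr_ge0//.
  by rewrite lerDl sqr_ge0.
by rewrite lerDr sqr_ge0.
Qed.

Lemma normc_le_ReIm (z : R[i]) : normc z <= `|complex.Re z| + `|complex.Im z|.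
Proof.
rewrite normc_sqrt -[leRHS]ger0_norm ?addr_ge0// -sqrtr_sqr ler_sqrt ?sqr_ge0//.
by rewrite sqrrD !real_normK ?num_real// addrAC lerDl mulrn_wge0// mulr_ge0.
Qed.

Lemma normc_real (x : R) : normc (real_complex R x) = `|x|.
Proof. by rewrite normc_sqrt /= expr0n /= addr0 sqrtr_sqr. Qed.

Lemma normcMreal (z : R[i]) (x : R) : normc (z * real_complex R x) = normc z * `|x|.
Proof. by rewrite ComplexField.Normc.normcM normc_real. Qed.

End modulus.

Section integrability.
Context {R : realType} {n : nat}.
Local Notation mu := (lebesgue_rV R n).
Local Notation normc := (@ComplexField.Normc.normc R).
Implicit Types (f : 'rV[R]_n -> R[i]) (K : set 'rV[R]_n).

Lemma measurable_normc f : measurable_fun setT (Re_fct f) ->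
  measurable_fun setT (Im_fct f) -> measurable_fun setT (normc \o f).
Proof.
move=> mr mi.
rewrite (_ : _ \o _ = fun x => Num.sqrt (Re_fct f x ^+ 2 + Im_fct f x ^+ 2)); last first.
  by apply/funext => x /=; rewrite normc_sqrt.
apply: (measurableT_comp (f := @Num.sqrt R)).
  by apply: continuous_measurable_fun; exact: sqrt_continuous.
by apply: measurable_funD; exact: measurable_funX.
Qed.

Lemma measurable_enormc f K : L1loc f -> measurable K ->
  measurable_fun K (fun x => (normc (f x))%:E).
Proof.
move=> [mr mi _] mK; apply/measurable_EFinP; apply: measurable_funTS.
exact: measurable_normc.
Qed.

Lemma continuous_L1loc f : continuous (Re_fct f) -> continuous (Im_fct f) -> L1loc f.
Proof.
move=> cr ci; split; [exact: continuous_measurable_rV|exact: continuous_measurable_rV|].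
move=> K cK.
have cf : continuous (fun x => `|Re_fct f x| + `|Im_fct f x|).
  have cn (g : 'rV[R]_n -> R) : continuous g -> continuous (fun x => `|g x|).
    move=> cg x; apply: (@continuous_comp _ _ _ g Num.norm); first exact: cg.
    exact: norm_continuous.
  by move=> x; apply: (@continuousD R R^o _ (fun x => `|Re_fct f x|)
    (fun x => `|Im_fct f x|)); exact: cn.
have [B [Br hB]] := compact_bounded (continuous_compact (continuous_subspaceT cf) cK).
have B1 x : K x -> normc (f x) <= B + 1.
  move=> Kx; have := hB (B + 1); rewrite ltrDl ltr01 => /(_ isT _ (imageP _ Kx)) /=.
  by apply: le_trans; rewrite ger0_norm ?addr_ge0// normc_le_ReIm.
have mK := compact_measurable_rV cK.
apply: (@le_lt_trans _ _ (\int[mu]_(x in K) (cst (B + 1)%:E) x)%E).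
  apply: ge0_le_integral => //.
  - by move=> x _; rewrite lee_fin normc_ge0.
  - apply/measurable_EFinP; apply: measurable_funTS.
    by apply: measurable_normc; exact: continuous_measurable_rV.
rewrite integral_cst// ltey_eq fin_numM// ge0_fin_numE//.
exact: compact_lebesgue_lty.
Qed.

End integrability.

Section sobolev_bfs.
Context {R : realType} {n : nat}.
Context (E : set ('rV[R]_n -> R[i])) (N : ('rV[R]_n -> R[i]) -> R).
Context (hE : TIBF_bounded_type E N).
Local Notation mu := (lebesgue_rV R n).
Local Notation normc := (@ComplexField.Normc.normc R).

(* A cube of side 1/(n+1) lies in the Euclidean unit ball, where [wM] applies. *)
Let side : R := n.+1%:R^-1.
Let side_gt0 : 0 < side. Proof. by rewrite invr_gt0. Qed.

Lemma cube_unit_ball (y : 'rV[R]_n) : cube side n y -> unit_ball (- y).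
Proof.
move=> hy; rewrite /unit_ball /rV_norm2 /= -sqrtr1 ltr_sqrt//.
apply: (@le_lt_trans _ _ (\sum_(i < n) side)).
  apply: ler_sum => i _; rewrite mxE sqrrN; have := hy i; rewrite /= in_itv /= => /andP[y0 ys].
  have s1 : side <= 1 by rewrite invf_le1 ?ler1n.
  by rewrite expr2 (le_trans (ler_wpM2l y0 ys))// ler_piMl ?(le_trans ys)// ltW.
rewrite sumr_const card_ord -[ltLHS]mulr_natl /side ltr_pdivrMr// mul1r ltr_nat.
exact: ltnSn.
Qed.

(** Transport of the Sobolev inequality to E: the integral over the cube at x is
    an integral over a fixed cube of a translate, hence bounded by the norm of E
    with a constant independent of x.  The functions h s majorise the weighted
    derivatives of g near x, c being a lower bound of the weight there. *)
Lemma sobolev_bfs : exists (L : seq (seq 'I_n)) (K : R), 0 <= K /\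
  forall (g : 'rV[R]_n -> R) (h : seq 'I_n -> 'rV[R]_n -> R[i]) (x : 'rV[R]_n) (c : R),
  smooth_real g -> 0 <= c -> (forall s, E (h s)) ->
  (forall s y, cube side n y ->
    c * `|foldr (@partial R n) g s (x + y)| <= normc (h s (x + y))) ->
  c * `|g x| <= K * \sum_(s <- L) N (h s).
Proof.
have [L [C [C0 hC]]] := @sobolev R side side_gt0 n.
have bfs := tibf_bfs hE.
have cK := @compact_cube R side n; have mK := @measurable_cube R side n.
have [D hD] := bfs_continuous bfs cK; have [C1 C10 hC1] := tibf_bounded hE.
exists L, (C * `|D| * C1); split; first by rewrite !mulr_ge0// ltW.
move=> g h x c sg c0 Eh hh.
have := hC _ (smooth_real_shift x sg); rewrite /= add0r => H.
have Th s : E (translate (- x) (h s)) by apply: (tibf_translate hE).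
have le_int s : (c%:E * \int[mu]_(v in cube side n)
      `|foldr (@partial R n) (fun y => g (y + x)) s v|%:E <=
    (`|D| * C1 * N (h s))%:E)%E.
  have mg : measurable_fun (cube side n)
      (fun v => `|foldr (@partial R n) (fun y => g (y + x)) s v|%:E).
    by apply: measurable_funTS; apply: measurable_abs_smooth; exact: smooth_real_shift.
  rewrite -ge0_integralZl_EFin//.
  apply: (@le_trans _ _ (\int[mu]_(v in cube side n) (normc (translate (- x) (h s) v))%:E)%E).
    apply: ge0_le_integral => //.
    + by move=> v _; rewrite mule_ge0// lee_fin.
    + exact: emeasurable_funM.
    + by apply: measurable_enormc mK; exact: (bfs_L1loc bfs).
    + move=> v vQ; rewrite foldr_partial_shift lee_fin /translate opprK addrC.
      exact: hh.
  apply: (le_trans (hD _ (Th s))); rewrite lee_fin -mulrA.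
  apply: (@le_trans _ _ (`|D| * N (translate (- x) (h s)))).
    by rewrite ler_wpM2r ?ler_norm// (bfs_norm_ge0 bfs).
  by rewrite ler_wpM2l// hC1.
have I0 s : (0 <= \int[mu]_(v in cube side n)
    `|foldr (@partial R n) (fun y => g (y + x)) s v|%:E)%E.
  by apply: integral_ge0 => v _; rewrite lee_fin.
rewrite -lee_fin EFinM; apply: (le_trans (lee_wpmul2l _ H)); first by rewrite lee_fin.
rewrite muleCA -mulrA -mulrA EFinM lee_wpmul2l ?lee_fin// mulrA mulr_sumr.
rewrite ge0_sume_distrr// -sumEFin; apply: lee_sum => s _; exact: le_int.
Qed.

Definition real_part (p : bool) (f : 'rV[R]_n -> R[i]) : 'rV[R]_n -> R :=
  if p then Re_fct f else Im_fct f.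

Lemma real_part_le p f x : `|real_part p f x| <= normc (f x).
Proof. by have [] := normc_ge_ReIm (f x); case: p. Qed.

Lemma real_part_mderiv p a f : real_part p (mderiv a f) = mderiv_real a (real_part p f).
Proof. by case: p. Qed.

(** The weight may be replaced by any c that it majorises on the neighbouring
    cube.  With c = 1 this bounds all derivatives of f; with c a smaller function
    of the system it is a weighted sup estimate. *)
Lemma weighted_sup_bound (M : {ffun 'I_n -> nat} -> R) (v c : 'rV[R]_n -> R) f p s :
  EMw E N M v f -> (forall x, 0 <= c x) ->
  (forall x y, cube side n y -> c x <= v (x + y)) ->
  exists K : R, forall x, c x * `|foldr (@partial R n) (real_part p f) s x| <= K.
Proof.
move=> [[sr si] Ef _] c0 cv; have [L [K [K0 hK]]] := sobolev_bfs.
have sp : smooth_real (real_part p f) by case: p.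
have [a ha] := choice (fun t => @foldr_partial_mderiv R n (t ++ s)).
exists (K * \sum_(t <- L) N (mul_weight (mderiv (a t) f) v)) => x.
apply: (hK (foldr (@partial R n) (real_part p f) s)
  (fun t => mul_weight (mderiv (a t) f) v) x (c x)) => //.
  exact: smooth_real_foldr.
move=> t y yQ; rewrite -foldr_cat ha// -real_part_mderiv /mul_weight normcMreal mulrC.
apply: ler_pM => //; first exact: real_part_le.
by rewrite (le_trans (cv _ _ yQ))// ler_norm.
Qed.

End sobolev_bfs.

(** * Normally convergent series in E *)

Section normal_series.
Context {R : realType} {n : nat}.
Context (E : set ('rV[R]_n -> R[i])) (N : ('rV[R]_n -> R[i]) -> R).
Context (bfs : banach_function_space E N).
Local Notation mu := (lebesgue_rV R n).
Local Notation normc := (@ComplexField.Normc.normc R).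
Implicit Types (f g : 'rV[R]_n -> R[i]).

Lemma bfs_zero : N (fun=> 0) = 0.
Proof.
have [_] := bfs_scale bfs 0 (bfs_0 bfs); under eq_fun do rewrite mul0r.
by rewrite ComplexField.Normc.normc0 mul0r.
Qed.

Lemma bfs_opp f : E f -> E (fun x => - f x) /\ N (fun x => - f x) = N f.
Proof.
move=> Ef; have [] := bfs_scale bfs (-1) Ef.
under eq_fun do rewrite mulN1r.
by rewrite normcN ComplexField.Normc.normc1 mul1r.
Qed.

Lemma bfs_sub f g : E f -> E g ->
  E (fun x => f x - g x) /\ N (fun x => f x - g x) <= N f + N g.
Proof. by move=> Ef /bfs_opp[Eg <-]; exact: (bfs_add bfs Ef Eg). Qed.

Lemma bfs_distC f g : E f -> E g -> N (fun x => f x - g x) = N (fun x => g x - f x).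
Proof.
move=> Ef Eg; have [Efg _] := bfs_sub Ef Eg; have [_ <-] := bfs_opp Efg.
by under eq_fun do rewrite opprB.
Qed.

Lemma bfs_sum (h : nat -> 'rV[R]_n -> R[i]) (s : seq nat) : (forall j, E (h j)) ->
  E (fun x => \sum_(j <- s) h j x) /\
  N (fun x => \sum_(j <- s) h j x) <= \sum_(j <- s) N (h j).
Proof.
move=> Eh; elim: s => [|j s [IHE IHN]].
  under eq_fun do rewrite big_nil; rewrite big_nil.
  by split; [exact: bfs_0 bfs|rewrite bfs_zero].
under eq_fun do rewrite big_cons; rewrite big_cons.
have [H1 H2] := bfs_add bfs (Eh j) IHE; split=> //.
by rewrite (le_trans H2)// lerD2l.
Qed.

(** R^n is a countable union of compact boxes. *)
Lemma ae_eq_compacts f g : L1loc f -> L1loc g ->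
  (forall K : set 'rV[R]_n, compact K ->
    (\int[mu]_(x in K) (normc (f x - g x))%:E = 0)%E) ->
  {ae mu, forall x, f x = g x}.
Proof.
move=> lf lg h.
pose K (k : nat) : set 'rV[R]_n := [set v | forall i, `[- k%:R, k%:R]%classic (v ord0 i)].
have cK k : compact (K k).
  by apply: (@rV_compact R n (fun=> `[- k%:R, k%:R]%classic)) => i; exact: segment_compact.
have mfg : measurable_fun setT (fun x => (normc (f x - g x))%:E).
  case: lf lg => [fr fi _] [gr gi _]; apply/measurable_EFinP.
  apply: (@measurable_normc R n (fun x => f x - g x)).
    rewrite (_ : Re_fct _ = Re_fct f \- Re_fct g); first exact: measurable_funB.
    by apply/funext => x; rewrite /Re_fct /=; case: (f x) (g x) => [? ?] [].
  rewrite (_ : Im_fct _ = Im_fct f \- Im_fct g); first exact: measurable_funB.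
  by apply/funext => x; rewrite /Im_fct /=; case: (f x) (g x) => [? ?] [].
have aeK k : {ae mu, forall x, K k x -> (normc (f x - g x))%:E = 0%E}.
  apply/(ae_eq_integral_abs mu (compact_measurable_rV (cK k))).
    exact: measurable_funTS.
  rewrite -[RHS](h _ (cK k)); apply: eq_integral => x _.
  by rewrite gee0_abs// lee_fin normc_ge0.
apply: filterS (ae_foralln aeK) => x hx.
pose k := (Num.truncn `|x|).+1.
have Kx : K k x.
  move=> i /=; rewrite in_itv /= -ler_norml; apply: le_trans (ltW (Num.Theory.truncnS_gt `|x|)).
  rewrite [leRHS]mx_normrE.
  exact: (le_bigmax _ (fun ij : 'I_1 * 'I_n => `|x ij.1 ij.2|) (ord0, i)).
have [] := hx _ Kx; move=> /ComplexField.Normc.eq0_normc /eqP.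
by rewrite subr_eq0 => /eqP.
Qed.

Lemma normc_dist (a b : R[i]) : `|normc a - normc b| <= normc (a - b).
Proof.
have tri (x y : R[i]) : normc x <= normc (x - y) + normc y.
  by rewrite -{1}(subrK y x); exact: le_normcD.
have sym : normc (a - b) = normc (b - a) by rewrite -(normcN (b - a)) opprB.
by rewrite ler_norml lerBlDr tri andbT -lerN2 opprK opprB lerBlDr sym tri.
Qed.

(** Convergence in E implies convergence in L^1_loc, so by Fatou's lemma the
    limit in E and the pointwise limit coincide almost everywhere. *)
Lemma bfs_limit (S : nat -> 'rV[R]_n -> R[i]) g H :
  (forall k, E (S k)) -> E g -> N (fun x => S k x - g x) @[k --> \oo] --> 0 ->
  L1loc H -> (forall x, normc (S k x - H x) @[k --> \oo] --> 0) ->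
  E H /\ N H = N g.
Proof.
move=> ES Eg Sg lH SH; have lg := bfs_L1loc bfs Eg.
apply: (bfs_ae bfs Eg lH); apply: (ae_eq_compacts lg lH) => K cK.
have mK := compact_measurable_rV cK.
have [C hC] := bfs_continuous bfs cK.
have ESg k : E (fun x => S k x - g x) by have [] := bfs_sub (ES k) Eg.
have f0 k x : (0 <= (normc (S k x - g x))%:E)%E by rewrite lee_fin normc_ge0.
have := @fatou _ _ R mu K mK (fun k x => (normc (S k x - g x))%:E)
  (fun k => measurable_enormc (bfs_L1loc bfs (ESg k)) mK) (fun k x _ => f0 k x).
have cv : (\int[mu]_(x in K) (normc (S k x - g x))%:E)%E @[k --> \oo] --> 0%E.
  apply: (@squeeze_cvge _ _ _ _ (cst 0%E) _ (fun k => (C * N (fun x => S k x - g x))%:E)).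
  - apply: nearW => k; apply/andP; split; last exact: hC.
    by apply: integral_ge0 => x _; exact: f0.
  - exact: cvg_cst.
  - by apply: cvg_EFin; [exact: nearW|rewrite -(mulr0 C); exact: cvgMr].
have [-> _] := cvg_limn_einf_sup cv.
under eq_integral => x _.
  have cvx : (normc (S k x - g x))%:E @[k --> \oo] --> (normc (g x - H x))%:E.
    apply: cvg_EFin; first exact: nearW.
    apply/cvgrPdist_le => e e0; have /cvgr0Pnorm_le/(_ _ e0) := SH x.
    apply: filterS => k /=; rewrite ger0_norm ?normc_ge0// => Sk.
    rewrite -[g x - H x]opprB normcN.
    apply: le_trans (normc_dist _ _) _.
    rewrite -normcN.
    by have -> : - (H x - g x - (S k x - g x)) = S k x - H x by ring.
  have [-> _] := cvg_limn_einf_sup cvx.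
  over.
move=> le0; apply/eqP; rewrite eq_le le0; apply: integral_ge0 => x _.
by rewrite lee_fin normc_ge0.
Qed.

(** Summable norms make the partial sums Cauchy; completeness provides a limit in
    E, which bfs_limit identifies with the pointwise sum. *)
Lemma bfs_series (h : nat -> 'rV[R]_n -> R[i]) H A :
  (forall j, E (h j)) -> (forall k, \sum_(0 <= j < k) N (h j) <= A) -> L1loc H ->
  (forall x, normc (\sum_(0 <= j < k) h j x - H x) @[k --> \oo] --> 0) ->
  E H /\ N H <= A.
Proof.
move=> Eh hA lH SH.
pose S k := fun x => \sum_(0 <= j < k) h j x.
have ES k : E (S k) by have [] := bfs_sum (index_iota 0 k) Eh.
have NS k : N (S k) <= A.
  by have [_ /le_trans] := bfs_sum (index_iota 0 k) Eh; apply.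
have N0 j : 0 <= N (h j) by exact: (bfs_norm_ge0 bfs).
have dS k l : (k <= l)%N -> N (fun x => S l x - S k x) <=
    series (fun j => N (h j)) l - series (fun j => N (h j)) k.
  move=> kl; rewrite sub_series_geq// /series.
  rewrite (_ : (fun x => _) = fun x => \sum_(k <= j < l) h j x).
    by have [] := bfs_sum (index_iota k l) Eh.
  apply/funext => x; rewrite /S (big_cat_nat (leq0n k) kl) /=.
  by rewrite addrAC subrr add0r.
have cs : cvgn (series (fun j => N (h j))).
  apply: nondecreasing_is_cvgn; first exact: nondecreasing_series.
  by exists A => _ [k _ <-]; exact: hA.
have [g Eg Sg] : exists2 g, E g & N (fun x => S k x - g x) @[k --> \oo] --> 0.
  apply: (bfs_complete bfs ES) => e e0.
  have /cvgr_dist_lt/(_ (e / 2)) := cs; rewrite divr_gt0// => /(_ isT)[k0 _ hk].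
  exists k0.
  have H1 k l : (k0 <= k)%N -> (k <= l)%N -> N (fun x => S l x - S k x) < e.
    move=> k0k kl; apply: (le_lt_trans (dS _ _ kl)); apply: (le_lt_trans (ler_norm _)).
    rewrite -(subrKA (limn (series (fun j => N (h j))))) (splitr e).
    apply: (le_lt_trans (ler_normD _ _)); rewrite distrC ltrD//; last exact: hk.
    by apply: hk => /=; exact: leq_trans kl.
  move=> k l k0k k0l; case: (leqP k l) => [kl|/ltnW lk]; last exact: H1.
  by rewrite bfs_distC//; exact: H1.
have [EH NH] := bfs_limit ES Eg Sg lH SH; split=> //.
rewrite NH; apply/ler_addgt0Pl => e e0.
have /cvgr0Pnorm_le/(_ _ e0)[k _ /(_ k (leqnn _)) /=] := Sg.
have [ESg _] := bfs_sub (ES k) Eg.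
rewrite ger0_norm ?(bfs_norm_ge0 bfs)// => Nk.
have [_] := bfs_sub (ES k) ESg.
under eq_fun do rewrite subKr.
by move=> /le_trans; apply; rewrite addrC lerD.
Qed.

End normal_series.

(** * Series of translates of a smooth function *)

Section weighted_sums.
Context {R : realType} (c : nat -> R) (A : R).
Context (cA : forall k, \sum_(0 <= j < k) `|c j| <= A).
Implicit Types (u v : nat -> R).

Definition wsum u : R := limn (series (fun j => c j * u j)).

Lemma wsum_norm_cvg u B : (forall j, `|u j| <= B) ->
  cvgn [normed series (fun j => c j * u j)].
Proof.
move=> uB; have B0 : 0 <= B by exact: le_trans (uB 0%N).
apply: nondecreasing_is_cvgn; first by apply: nondecreasing_series => *; exact: normr_ge0.
exists (A * B) => _ [k _ <-]; apply: le_trans (ler_wpM2r B0 (cA k)).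
by rewrite mulr_suml; apply: ler_sum => j _; rewrite /= normrM ler_wpM2l.
Qed.

Lemma wsum_cvg u B : (forall j, `|u j| <= B) ->
  series (fun j => c j * u j) @ \oo --> wsum u.
Proof.
move=> uB; rewrite /wsum; apply: normed_cvg. exact: wsum_norm_cvg uB.
Qed.

Lemma wsum_le u B : (forall j, `|u j| <= B) -> `|wsum u| <= A * B.
Proof.
move=> uB; have B0 : 0 <= B by exact: le_trans (uB 0%N).
apply: (le_trans (@lim_series_norm R R _ (wsum_norm_cvg uB))).
apply: limr_le; first exact: wsum_norm_cvg uB.
apply: nearW => k; apply: le_trans (ler_wpM2r B0 (cA k)).
by rewrite mulr_suml; apply: ler_sum => j _; rewrite /= normrM ler_wpM2l.
Qed.

Lemma wsumB u v B : (forall j, `|u j| <= B) -> (forall j, `|v j| <= B) ->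
  wsum (fun j => u j - v j) = wsum u - wsum v.
Proof.
move=> uB vB; apply: cvg_lim => //.
have -> : series (fun j => c j * (u j - v j)) =
    series (fun j => c j * u j) - series (fun j => c j * v j).
  apply/funext => k; apply: etrans (sumrB _ _ _ _).
  by apply: eq_bigr => j _; rewrite mulrBr.
by apply: cvgB; [exact: wsum_cvg uB|exact: wsum_cvg vB].
Qed.

Lemma wsumZ (h : R) u B : (forall j, `|u j| <= B) ->
  wsum (fun j => h * u j) = h * wsum u.
Proof.
move=> uB; apply: cvg_lim => //.
rewrite (_ : series _ = (fun k => h * series (fun j => c j * u j) k)).
  by apply: cvgMr; exact: wsum_cvg uB.
apply/funext => k; rewrite /series /= mulr_sumr.
by apply: eq_bigr => j _; rewrite mulrCA.
Qed.

End weighted_sums.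

Section translate_series.
Context {R : realType} {n : nat}.
Local Notation e i := (delta_mx ord0 i : 'rV[R]_n).
Implicit Types (g : 'rV[R]_n -> R).

(** Move from z to x one coordinate at a time. *)
Lemma partial_lipschitz g B : (forall i x, derivable g x (e i)) ->
  (forall i x, `|partial i g x| <= B) ->
  forall x z, `|g x - g z| <= B * n%:R * `|x - z|.
Proof.
move=> dg gB x z; have Bx (i : 'I_n) : 0 <= B by exact: le_trans (gB i 0).
have path (s : seq 'I_n) :
    `|g (z + \sum_(i <- s) (x - z) ord0 i *: e i) - g z| <= \sum_(i <- s) B * `|x - z|.
  elim: s => [|i s IH]; first by rewrite !big_nil addr0 subrr normr0.
  rewrite !big_cons addrCA [_ *: _ + _]addrC.
  set y := z + _ in IH *; rewrite -(subrKA (g y)) (le_trans (ler_normD _ _))// lerD//.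
  apply: (le_trans (line_lipschitz y _ (dg i) (gB i))); rewrite ler_wpM2l ?(Bx i)//.
  rewrite [leRHS]mx_normrE.
  exact: (le_bigmax _ (fun ij : 'I_1 * 'I_n => `|(x - z) ij.1 ij.2|) (ord0, i)).
have := path (enum 'I_n); rewrite !big_enum /= -row_sum_delta [z + _]addrC subrK.
by rewrite sumr_const card_ord -mulrnAl mulr_natr.
Qed.

Context (c : nat -> R) (A : R) (cA : forall k, \sum_(0 <= j < k) `|c j| <= A).
Context (y : nat -> 'rV[R]_n).

Definition tseries g : 'rV[R]_n -> R := fun x => wsum c (fun j => g (x - y j)).

(** Termwise differentiation: by line_taylor the error of each difference
    quotient is at most B |h|, and these errors sum to at most A B |h|. *)
Lemma is_derive_tseries g i B x :
  (forall x, `|g x| <= B) -> (forall x, derivable g x (e i)) ->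
  (forall x, `|partial i g x| <= B) -> (forall x, derivable (partial i g) x (e i)) ->
  (forall x, `|partial i (partial i g) x| <= B) ->
  is_derive x (e i) (tseries g) (tseries (partial i g) x).
Proof.
move=> gB dg g1B dg1 g2B; have A0 : 0 <= A by have := cA 0; rewrite big_geq.
have B0 : 0 <= B by exact: le_trans (gB 0).
suff : (fun h : R => h^-1 *: ((tseries g \o shift x) (h *: e i) - tseries g x)) @ 0^'
    --> tseries (partial i g) x.
  by move=> cv; apply: DeriveDef; [apply/cvg_ex; eexists; exact: cv|exact: cvg_lim].
have bound h : `|tseries g (h *: e i + x) - tseries g x - h * tseries (partial i g) x|
    <= A * (B * `|h| ^+ 2).
  rewrite /tseries -(wsumB cA (B := B))// -(wsumZ cA h (B := B))//.
  rewrite -(wsumB cA (B := Num.max (B + B) (`|h| * B))); last 2 first.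
  - by move=> j; rewrite le_max (le_trans (ler_normB _ _))// lerD.
  - by move=> j; rewrite le_max normrM ler_wpM2l// orbT.
  apply: wsum_le => // j.
  have -> : h *: e i + x - y j = (x - y j) + h *: e i by rewrite -addrA addrC.
  exact: line_taylor.
apply/cvgrPdist_le => eps eps0.
have AB0 : 0 < A * B + 1 by rewrite ltr_wpDl// mulr_ge0.
near=> h.
have h0 : h != 0 by near: h; exact: nbhs_dnbhs_neq.
have hs : `|h| <= eps / (A * B + 1).
  near: h; apply: dnbhs0_le; exact: divr_gt0.
have nh : 0 < `|h| by rewrite normr_gt0.
rewrite distrC /=.
have -> : h^-1 *: (tseries g (h *: e i + x) - tseries g x) - tseries (partial i g) x =
   h^-1 * (tseries g (h *: e i + x) - tseries g x - h * tseries (partial i g) x).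
  by rewrite [RHS]mulrBr mulKf.
rewrite normrM normfV ler_pdivrMl//; apply: (le_trans (bound h)).
rewrite expr2 !mulrA mulrC -!mulrA ler_wpM2l// mulrA mulrC.
move: hs; rewrite ler_pdivlMr// => /(le_trans _); apply.
by rewrite ler_wpM2l// lerDl.
Unshelve. all: by end_near. Qed.

Context (g : 'rV[R]_n -> R) (sg : smooth_real g) (B : seq 'I_n -> R).
Context (gB : forall s x, `|foldr (@partial R n) g s x| <= B s).

Lemma is_derive_tseries_foldr s i x :
  is_derive x (e i) (tseries (foldr (@partial R n) g s))
    (tseries (foldr (@partial R n) g (i :: s)) x).
Proof.
pose B3 := Num.max (B s) (Num.max (B (i :: s)) (B [:: i, i & s])).
apply: (@is_derive_tseries _ _ B3).
- by move=> z; rewrite le_max gB.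
- by move=> z; have [_] := sg s; exact.
- by move=> z; rewrite !le_max (gB (i :: s)) orbT.
- by move=> z; have [_] := sg (i :: s); exact.
- by move=> z; rewrite !le_max (gB [:: i, i & s]) !orbT.
Qed.

Lemma foldr_partial_tseries s :
  foldr (@partial R n) (tseries g) s = tseries (foldr (@partial R n) g s).
Proof.
elim: s => //= i s ->; apply/funext => x; rewrite {1}/partial.
by have [] := is_derive_tseries_foldr s i x.
Qed.

(** The derivatives of the series are bounded, so each is Lipschitz. *)
Lemma smooth_real_tseries : smooth_real (tseries g).
Proof.
move=> s; rewrite foldr_partial_tseries; set F := tseries _.
have dF i x : derivable F x (e i) by have [] := is_derive_tseries_foldr s i x.
split=> //.
have [D D0 hD] : exists2 D, 0 <= D & forall i x, `|partial i F x| <= D.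
  exists (\sum_i `|A * B (i :: s)|); first exact: sumr_ge0.
  move=> i x; rewrite (bigD1 i)//= ler_wpDr ?sumr_ge0//.
  rewrite /partial; have [_ ->] := is_derive_tseries_foldr s i x.
  by apply: le_trans (ler_norm _); apply: wsum_le => // j; exact: (gB (i :: s)).
move=> x; apply/(@cvgrPdist_le _ R _ (nbhs x) (nbhs_filter x) F (F x)) => eps eps0.
have C0 : 0 < D * n%:R + 1 by rewrite ltr_wpDl// mulr_ge0.
have pos : 0 < eps / (D * n%:R + 1) by exact: divr_gt0.
have := nbhsx_ballx x _ pos; rewrite -ball_normE; apply: filterS => z /= xz.
apply: (le_trans (partial_lipschitz dF hD x z)).
apply: (@le_trans _ _ ((D * n%:R + 1) * `|x - z|)); first by rewrite ler_wpM2r// lerDl.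
by rewrite mulrC -ler_pdivlMr// ltW.
Qed.

End translate_series.

(** * The gliding hump *)

Section gliding_hump.
Context {R : realType}.

Lemma geometric_half_le m k : \sum_(m <= j < k) 2^-1 ^+ j <= 2 :> R.
Proof.
have half0 j : 0 <= 2^-1 ^+ j :> R by rewrite exprn_ge0// invr_ge0.
have [km|/ltnW mk] := leqP k m; first by rewrite big_geq.
have full : \sum_(0 <= j < k) 2^-1 ^+ j = 2 - 2 * 2^-1 ^+ k :> R.
  elim: k {mk} => [|k IH]; first by rewrite big_geq// expr0 mulr1 subrr.
  by rewrite big_nat_recr//= IH exprS; field.
apply: (@le_trans _ _ (\sum_(0 <= j < k) 2^-1 ^+ j)); last by rewrite full gerBl mulr_ge0.
by rewrite [leRHS](big_cat_nat (leq0n m) mk) /= lerDr sumr_ge0.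
Qed.

Lemma align_sign (p q : R) : exists2 s : R, `|s| = 1 & `|q| <= `|p + s * q|.
Proof.
have [pq|pq] := leP 0 (p * q).
  exists 1; first exact: normr1.
  rewrite mul1r -ler_sqr ?nnegrE// !real_normK ?num_real// sqrrD.
  by rewrite lerDr addr_ge0 ?sqr_ge0// mulrn_wge0.
exists (-1); first exact: normrN1.
rewrite mulN1r -ler_sqr ?nnegrE// !real_normK ?num_real// sqrrB.
by rewrite lerDr addr_ge0 ?sqr_ge0// oppr_ge0 mulrn_wle0// ltW.
Qed.

Context {T : zmodType} (g : T -> R) (B : R) (a : T) (wt vt : nat -> T -> R).
Context (gB : forall x, `|g x| <= B).
Context (wt1 : forall j x, 1 <= wt j x) (vt1 : forall j x, 1 <= vt j x).
Context (unbounded : forall j C, exists x, C * wt j x < vt j x).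

(** One step of the construction at stage p.1: p.2.1 is the sum F of the terms
    already chosen and p.2.2 a bound m for the values of the target weights at
    the earlier centres.  The coefficient is 2^-j / (m wt x) up to sign; dividing
    by m keeps the new term small at the earlier centres. *)
Lemma hump_step (p : nat * ((T -> R) * R)) : exists q : T * R, 0 < p.2.2 ->
  `|q.2| * wt p.1 q.1 <= 2^-1 ^+ p.1 / p.2.2 /\
  p.1%:R * `|g a| <= `|p.2.1 q.1 + q.2 * g a| * vt p.1 q.1.
Proof.
case: p => j [F m] /=; have [m0|m0] := ltP 0 m; last by exists (a, 0).
have h0 : 0 < 2^-1 ^+ j :> R by rewrite exprn_gt0// invr_gt0.
have [x hx] := unbounded j (j%:R / (2^-1 ^+ j / m)).
have w0 : 0 < wt j x by exact: lt_le_trans (wt1 _ _).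
have v0 : 0 < vt j x by exact: lt_le_trans (vt1 _ _).
pose c := 2^-1 ^+ j / m / wt j x.
have c0 : 0 < c by rewrite !divr_gt0.
have [s s1 hs] := align_sign (F x) (c * g a).
exists (x, s * c) => _ /=; split.
  by rewrite normrM s1 mul1r gtr0_norm// /c divfK// gt_eqF.
rewrite -mulrA; apply: le_trans (ler_wpM2r (ltW v0) hs).
rewrite normrM (gtr0_norm c0) mulrAC ler_wpM2r//.
by rewrite /c mulrAC ler_pdivlMr// -ler_pdivrMl ?divr_gt0// mulrC mulrAC ltW.
Qed.

(** At x_k the terms up to k have weighted size at least k |g a|, by the choice
    made in hump_step, and the later ones add up to at most B * 2, since their
    coefficients were divided by a number that is at least vt k (x k). *)
Lemma gliding_hump : exists (x : nat -> T) (c : nat -> R),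
  [/\ forall j, `|c j| * wt j (x j) <= 2^-1 ^+ j,
      forall k, \sum_(0 <= j < k) `|c j| <= 2 &
      forall k, k%:R * `|g a| <=
        `|wsum c (fun j => g (x k - (x j - a)))| * vt k (x k) + B * 2].
Proof.
have B0 : 0 <= B by exact: le_trans (gB a).
have [step hstep] := choice hump_step.
(* The state records the current partial sum and 1 + sum_(i < j) vt i (x i). *)
pose upd j (st : (T -> R) * R) :=
  let q := step (j, st) in
  ((fun z => st.1 z + q.2 * g (z - (q.1 - a))), st.2 + vt j q.1).
pose st := fix st j := if j is i.+1 then upd i (st i) else (fun=> 0, 1) : (T -> R) * R.
pose x j := (step (j, st j)).1; pose c j := (step (j, st j)).2.
have v0 j : 0 < vt j (x j) by exact: lt_le_trans (vt1 _ _).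
have st1 j : 1 <= (st j).2.
  by elim: j => //= j IH; rewrite -[leLHS]addr0 lerD// ltW// v0.
have stv i j : (i < j)%N -> vt i (x i) <= (st j).2.
  elim: j => // j IH; rewrite ltnS leq_eqVlt => /predU1P[->|ij] /=.
    by rewrite lerDr (le_trans _ (st1 j)).
  by apply: le_trans (IH ij) _; rewrite lerDl ltW// v0.
have stF k z : (st k).1 z = \sum_(0 <= j < k) c j * g (z - (x j - a)).
  by elim: k => [|k IH]; [rewrite big_geq|rewrite big_nat_recr//= -IH].
have st0 j : 0 < (st j).2 by exact: lt_le_trans (st1 j).
have hc j := (hstep (j, st j) (st0 j)).1; have hF j := (hstep (j, st j) (st0 j)).2.
have half0 j : 0 <= 2^-1 ^+ j :> R by rewrite exprn_ge0// invr_ge0.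
have cw j : `|c j| <= 2^-1 ^+ j / (st j).2.
  by apply: le_trans (hc j); rewrite ler_peMr.
have ch j : `|c j| <= 2^-1 ^+ j.
  by apply: le_trans (cw j) _; rewrite ler_pdivrMr// ler_peMr.
have c2 k : \sum_(0 <= j < k) `|c j| <= 2.
  apply: (@le_trans _ _ (\sum_(0 <= j < k) 2^-1 ^+ j)); first exact: ler_sum.
  exact: geometric_half_le.
exists x, c; split=> //.
  move=> j; apply: le_trans (hc j) _; by rewrite /= ler_pdivrMr// ler_peMr.
move=> k; set u := fun j => _; set v := vt k (x k).
have uB j : `|u j| <= B by exact: gB.
have head : k%:R * `|g a| <= `|series (fun j => c j * u j) k.+1| * v.
  apply: le_trans (hF k) _; rewrite [X in `|X + _|]stF /= /series /= big_nat_recr//= /u.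
  by rewrite subKr.
(* The tail is estimated on partial sums, up to an arbitrary eps. *)
suff tail : `|wsum c u - series (fun j => c j * u j) k.+1| * v <= B * 2.
  apply: (le_trans head); rewrite -(subrK (wsum c u) (series _ _)) addrC.
  apply: (le_trans (ler_wpM2r (ltW (v0 k)) (ler_normD _ _))).
  by rewrite mulrDl lerD2l distrC.
apply/ler_addgt0Pl => eps eps0.
have /cvgrPdist_le/(_ (eps / v)) := wsum_cvg c2 uB.
rewrite divr_gt0 ?v0// => /(_ isT)[l0 _ hl].
pose l := maxn l0 k.+1.
have {hl} hl : `|wsum c u - series (fun j => c j * u j) l| * v <= eps.
  by rewrite -ler_pdivlMr ?v0//; apply: hl; exact: leq_maxl.
rewrite -(subrKA (series (fun j => c j * u j) l)).
apply: (le_trans (ler_wpM2r (ltW (v0 k)) (ler_normD _ _))).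
rewrite mulrDl lerD//.
rewrite sub_series_geq ?leq_maxr//.
apply: (le_trans (ler_wpM2r (ltW (v0 k)) (ler_norm_sum _ _ _))).
rewrite mulr_suml.
apply: (@le_trans _ _ (\sum_(k.+1 <= j < l) B * 2^-1 ^+ j)).
  rewrite big_seq [leRHS]big_seq; apply: ler_sum => j; rewrite mem_index_iota => /andP[kj _].
  rewrite normrM mulrAC mulrC ler_pM ?mulr_ge0// ?(ltW (v0 k))//.
  apply: (@le_trans _ _ (`|c j| * (st j).2)).
    by rewrite ler_wpM2l// stv.
  by rewrite -ler_pdivlMr.
by rewrite -mulr_sumr ler_wpM2l// geometric_half_le.
Qed.

End gliding_hump.

(** * Series of translates in the weighted spaces *)

Section complex_sums.
Context {R : realType}.

Lemma complex_sum (s : seq nat) (a b : nat -> R) :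
  \sum_(j <- s) Complex (a j) (b j) = Complex (\sum_(j <- s) a j) (\sum_(j <- s) b j).
Proof. by elim: s => [|j s IH]; rewrite ?big_nil// !big_cons IH. Qed.

Lemma mulr_complex (c a b w : R) :
  real_complex R c * (Complex a b * real_complex R w) = Complex (c * a * w) (c * b * w).
Proof.
by congr Complex; rewrite ?mulr0 ?mul0r ?subr0 ?addr0 ?add0r ?sub0r mulrA.
Qed.

End complex_sums.

Section gelfand_shilov.
Context {R : realType} {n : nat}.
Context (E : set ('rV[R]_n -> R[i])) (N : ('rV[R]_n -> R[i]) -> R).
Context (hE : TIBF_bounded_type E N) (hS : solid E N).
Local Notation normc := (@ComplexField.Normc.normc R).
Local Notation mindex := {ffun 'I_n -> nat}.
Implicit Types (f phi : 'rV[R]_n -> R[i]) (M : mindex -> R) (w v : 'rV[R]_n -> R).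

Lemma EMw_norm_bound M w f : (forall a, 0 < M a) -> EMw E N M w f ->
  exists2 K : R, 0 <= K & forall a, N (mul_weight (mderiv a f) w) <= K * M a.
Proof.
move=> M0 [_ Ef fin].
have ub a : ((N (mul_weight (mderiv a f) w) / M a)%:E <= EMw_norm N M w f)%E.
  by apply: ereal_sup_ubound; exists a.
have fn : EMw_norm N M w f \is a fin_num.
  by rewrite fin_numElt fin andbT; apply: lt_le_trans (ub [ffun=> 0%N]); rewrite ltNyr.
exists (fine (EMw_norm N M w f)).
  apply: fine_ge0; apply: le_trans (ub [ffun=> 0%N]).
  by rewrite lee_fin divr_ge0 ?(ltW (M0 _))// (bfs_norm_ge0 (tibf_bfs hE)).
by move=> a; rewrite -ler_pdivrMr// -lee_fin fineK.
Qed.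

Lemma smooth_mderiv_continuous f a p : smooth f -> continuous (real_part p (mderiv a f)).
Proof.
case=> sr si; rewrite real_part_mderiv mderiv_realE.
by apply: smooth_real_continuous; apply: smooth_real_foldr; case: p.
Qed.

Lemma continuous_mul_weight f w : (forall p, continuous (real_part p f)) ->
  continuous w -> L1loc (mul_weight f w).
Proof.
move=> cf cw.
have cp p : continuous (fun x => real_part p f x * w x).
  by move=> x; apply: (@continuousM R _ (real_part p f) w); [exact: cf|exact: cw].
apply: continuous_L1loc.
  rewrite (_ : Re_fct _ = fun x => real_part true f x * w x); first exact: cp.
  apply/funext => x; rewrite /Re_fct /mul_weight /real_part /Re_fct.
  by case: (f x) => a b /=; rewrite mulr0 subr0.
rewrite (_ : Im_fct _ = fun x => real_part false f x * w x); first exact: cp.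
apply/funext => x; rewrite /Im_fct /mul_weight /real_part /Im_fct.
by case: (f x) => a b /=; rewrite mulr0 add0r mulrC.
Qed.

Lemma translate_real_part f y p :
  real_part p (translate y f) = fun x => real_part p f (x + (- y)).
Proof. by case: p. Qed.

(** w t <= C w' (t - y) gives the pointwise bound of the weighted translate by
    C times a translate of an element of E; conclude by solidity.  In the
    application C is a constant times w(y), by [M]. *)
Lemma translate_weight_bound M w w' phi K C0 C y a : smooth phi ->
  (forall a, E (mul_weight (mderiv a phi) w')) ->
  (forall a, N (mul_weight (mderiv a phi) w') <= K * M a) ->
  (forall x f, E f -> N (translate x f) <= C0 * N f) -> 0 <= C0 -> 0 <= C ->
  continuous w -> (forall t, 0 <= w t) -> (forall t, 0 <= w' t) ->
  (forall t, w t <= C * w' (t - y)) ->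
  E (mul_weight (translate y (mderiv a phi)) w) /\
  N (mul_weight (translate y (mderiv a phi)) w) <= C * (C0 * (K * M a)).
Proof.
move=> sphi Ephi NK hC0 C00 Cge cw w0 w'0 ww'.
pose G := translate y (mul_weight (mderiv a phi) w').
have EG : E G by exact: (tibf_translate hE).
have [ECG NCG] := bfs_scale (tibf_bfs hE) (real_complex R C) EG.
have LH : L1loc (mul_weight (translate y (mderiv a phi)) w).
  apply: continuous_mul_weight => // p; rewrite translate_real_part.
  by apply: continuous_shift; exact: smooth_mderiv_continuous.
have [|EH NH] := hS ECG LH.
  apply: aeW => t; rewrite [leRHS]ComplexField.Normc.normcM normc_real ger0_norm//.
  rewrite /G /translate /mul_weight !normcMreal !ger0_norm// mulrCA.
  by rewrite ler_wpM2l ?normc_ge0.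
split=> //; apply: (le_trans NH); rewrite NCG normc_real ger0_norm// ler_wpM2l//.
by apply: le_trans (hC0 _ _ (Ephi a)) _; rewrite ler_wpM2l.
Qed.

Definition cseries (c : nat -> R) (y : nat -> 'rV[R]_n) phi : 'rV[R]_n -> R[i] :=
  fun x => Complex (tseries c y (Re_fct phi) x) (tseries c y (Im_fct phi) x).

Lemma real_part_cseries c y phi p :
  real_part p (cseries c y phi) = tseries c y (real_part p phi).
Proof. by case: p. Qed.

(** Each derivative of the series is the series of the derivatives; for it the
    norms of the terms sum to at most D M_a, uniformly in a. *)
Lemma cseries_EMw M w phi c y A D (om : nat -> R) (B : bool -> seq 'I_n -> R) :
  (forall a, 0 < M a) -> continuous w -> smooth phi ->
  (forall p s x, `|foldr (@partial R n) (real_part p phi) s x| <= B p s) ->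
  (forall k, \sum_(0 <= j < k) `|c j| <= A) ->
  (forall a j, E (mul_weight (translate (y j) (mderiv a phi)) w) /\
     N (mul_weight (translate (y j) (mderiv a phi)) w) <= om j * M a) ->
  (forall k, \sum_(0 <= j < k) `|c j| * om j <= D) ->
  EMw E N M w (cseries c y phi).
Proof.
move=> M0 cw [sr si] phiB cA hom hD.
have sp p : smooth_real (real_part p phi) by case: p.
have scs : smooth (cseries c y phi).
  by split; [exact: (smooth_real_tseries cA y (sp true) (phiB true))|
             exact: (smooth_real_tseries cA y (sp false) (phiB false))].
have dcs p a : real_part p (mderiv a (cseries c y phi)) =
    tseries c y (real_part p (mderiv a phi)).
  rewrite !real_part_mderiv real_part_cseries !mderiv_realE.
  exact: (foldr_partial_tseries cA y (sp p) (phiB p)).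
have main a : E (mul_weight (mderiv a (cseries c y phi)) w) /\
    N (mul_weight (mderiv a (cseries c y phi)) w) <= D * M a.
  pose h j x := real_complex R (c j) * mul_weight (translate (y j) (mderiv a phi)) w x.
  have hh j : E (h j) /\ N (h j) = normc (real_complex R (c j)) *
      N (mul_weight (translate (y j) (mderiv a phi)) w).
    by apply: (bfs_scale (tibf_bfs hE)); have [] := hom a j.
  apply: (bfs_series (tibf_bfs hE) (h := h)).
  - by move=> j; have [] := hh j.
  - move=> k; apply: le_trans (ler_wpM2r (ltW (M0 a)) (hD k)).
    rewrite mulr_suml; apply: ler_sum => j _; have [_ ->] := hh j.
    by rewrite normc_real -mulrA ler_wpM2l//; have [] := hom a j.
  - apply: continuous_mul_weight => // p; exact: smooth_mderiv_continuous.
  - move=> x.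
    pose u p j := real_part p (mderiv a phi) (x - y j).
    have uB p j : `|u p j| <= B p (mindex_seq a).
      by rewrite /u real_part_mderiv mderiv_realE.
    have hE' j : h j x = Complex (c j * u true j * w x) (c j * u false j * w x).
      exact: mulr_complex.
    have HE' : mul_weight (mderiv a (cseries c y phi)) w x =
        Complex (wsum c (u true) * w x) (wsum c (u false) * w x).
      have dt := congr1 (fun F => F x) (dcs true a).
      have df := congr1 (fun F => F x) (dcs false a).
      rewrite /real_part /tseries /= in dt df.
      rewrite /mul_weight /= -/(u true) -/(u false).
      rewrite -[LHS]mul1r -[1]/(real_complex R 1) mulr_complex !mul1r.
      by congr Complex; congr (_ * _); [exact: dt|exact: df].
    apply: (@squeeze_cvgr _ _ _ _ (cst 0) (fun k =>
      `|series (fun j => c j * u true j) k - wsum c (u true)| * `|w x| +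
      `|series (fun j => c j * u false j) k - wsum c (u false)| * `|w x|)).
    + apply: nearW => k; rewrite normc_ge0 /= HE'.
      under eq_bigr do rewrite hE'.
      rewrite complex_sum -!mulr_suml.
      rewrite -[_ - _]/(Complex (_ - _) (_ - _)) -!mulrBl -!normrM.
      exact: (normc_le_ReIm (Complex _ _)).
    + exact: cvg_cst.
    + rewrite -[0](addr0 (0 : R)).
      have cvp p : `|series (fun j => c j * u p j) k - wsum c (u p)| * `|w x|
          @[k --> \oo] --> 0.
        rewrite -[X in _ --> X](mul0r `|w x|) -(normr0 R) -(subrr (wsum c (u p))).
        apply: cvgMl; apply: cvg_norm; apply: cvgB; last exact: cvg_cst.
        exact: (wsum_cvg cA (uB p)).
      by apply: cvgD.
split=> //; first by move=> a; have [] := main a.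
apply: (@le_lt_trans _ _ D%:E); last exact: ltry.
apply: ge_ereal_sup => _ [a _ <-]; rewrite lee_fin ler_pdivrMr//.
by have [] := main a.
Qed.

Lemma EMw0 M w : (forall a, 0 < M a) -> EMw E N M w (fun=> 0).
Proof.
move=> M0.
have d0 s : foldr (@partial R n) (fun=> 0) s = (fun=> 0).
  by elim: s => //= i s ->; apply/funext => x; exact: derive_cst.
have s0 : smooth_real (fun _ : 'rV[R]_n => 0 : R).
  by move=> s; rewrite d0; split=> [|i x]; [exact: cst_continuous|exact: derivable_cst].
have m0 a : mul_weight (mderiv a (fun=> 0)) w = fun=> 0.
  apply/funext => x; rewrite /mul_weight /mderiv.
  have -> : Re_fct (fun _ : 'rV[R]_n => 0 : R[i]) = fun=> 0 by [].
  have -> : Im_fct (fun _ : 'rV[R]_n => 0 : R[i]) = fun=> 0 by [].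
  by rewrite !mderiv_realE !d0 mul0r.
split=> [|a|]; first by split.
  by rewrite m0; exact: bfs_0 (tibf_bfs hE).
apply: (@le_lt_trans _ _ 0%E) => //.
by apply: ge_ereal_sup => _ [a _ <-]; rewrite m0 (bfs_zero (tibf_bfs hE)) mul0r.
Qed.

End gelfand_shilov.

(** * The inclusion theorem *)

Section test_function.
Context {R : realType} {n : nat}.
Context (E : set ('rV[R]_n -> R[i])) (N : ('rV[R]_n -> R[i]) -> R).
Context (hE : TIBF_bounded_type E N) (hS : solid E N).
Local Notation mindex := {ffun 'I_n -> nat}.

(** The series f of translates of phi produced by the gliding hump, in a form
    common to both cases: f belongs to every space whose weight w is, up to om,
    moderate with respect to a weight of a space containing phi; but the values
    of f at the points x k are not O(1 / vt k (x k)).  The centres of the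
    translates are x j - a because phi is nonzero at a. *)
Lemma exists_test_series (M0 : mindex -> R) (w0 : 'rV[R]_n -> R)
    (phi : 'rV[R]_n -> R[i]) (wt vt : nat -> 'rV[R]_n -> R) :
  (forall a, 0 < M0 a) -> (forall t, 1 <= w0 t) -> EMw E N M0 w0 phi ->
  phi <> (fun=> 0) ->
  (forall j x, 1 <= wt j x) -> (forall j x, 1 <= vt j x) ->
  (forall j C, exists x, C * wt j x < vt j x) ->
  exists (f : 'rV[R]_n -> R[i]) (p : bool) (a : 'rV[R]_n) (x : nat -> 'rV[R]_n)
    (c : nat -> R),
  [/\ forall j, `|c j| * wt j (x j) <= 2^-1 ^+ j,
      forall (M M1 : mindex -> R) (w w1 : 'rV[R]_n -> R) C D (om : 'rV[R]_n -> R),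
        EMw E N M1 w1 phi -> (forall b, 0 < M1 b) -> (forall b, M1 b <= M b) ->
        (forall t, 0 <= w1 t) ->
        continuous w -> (forall t, 0 <= w t) -> 0 <= C -> (forall z, 0 <= om z) ->
        (forall t z, w t <= C * om z * w1 (t - (z - a))) ->
        (forall k, \sum_(0 <= j < k) `|c j| * om (x j) <= D) ->
        EMw E N M w f &
      forall K k0, ~ (forall k, (k0 <= k)%N ->
        `|real_part p f (x k)| * vt k (x k) <= K)].
Proof.
move=> M00 w01 hphi phi0 wt1 vt1 unb; have [sphi Ephi _] := hphi.
have [p [a pa0]] : exists p a, real_part p phi a != 0.
  apply: contrapT => nex; apply: phi0; apply/funext => a.
  have z p : real_part p phi a = 0.
    by apply/eqP; apply: contrapT => h; apply: nex; exists p, a; exact/negP.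
  have := z true; have := z false; rewrite /real_part /Re_fct /Im_fct.
  by case: (phi a) => u v /= -> ->.
have w00 t : 0 <= w0 t by exact: le_trans (w01 t).
have bound q s : exists K : R, forall x,
    `|foldr (@partial R n) (real_part q phi) s x| <= K.
  have [|x y _|K hK] := weighted_sup_bound hE q s hphi (c := fun=> 1); [by []|exact: w01|].
  by exists K => x; have := hK x; rewrite mul1r.
have [B hB] := choice (fun qs => bound qs.1 qs.2).
have gB x : `|real_part p phi x| <= B (p, [::]) by exact: (hB (p, [::])).
have [x [c [cw c2 hump]]] := gliding_hump a gB wt1 vt1 unb.
exists (cseries c (fun j => x j - a) phi), p, a, x, c; split=> //.
- move=> M M1 w w1 C D om hphi1 M1pos M1M w10 cw' w'0 C0 om0 hw hD.
  have [_ Ephi1 _] := hphi1; have [K K0 hK] := EMw_norm_bound hE M1pos hphi1.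
  have Mpos d : 0 < M d by exact: lt_le_trans (M1pos d) (M1M d).
  have [C1 C10 hC1] := tibf_bounded hE.
  apply: (@cseries_EMw R n E N hE M w phi c (fun j => x j - a) 2 (D * (C * (C1 * K)))
    (fun j => om (x j) * (C * (C1 * K))) (fun q s => B (q, s))) => //.
  + by move=> q s z; exact: (hB (q, s)).
  + move=> b j.
    have NK d : N (mul_weight (mderiv d phi) w1) <= K * M d.
      by apply: le_trans (hK d) _; rewrite ler_wpM2l.
    have [h1 h2] := @translate_weight_bound R n E N hE hS M w w1 phi K C1
      (C * om (x j)) (x j - a) b sphi Ephi1 NK hC1 (ltW C10) (mulr_ge0 C0 (om0 _))
      cw' w'0 w10 (fun t => hw t (x j)).
    split=> //; apply: (le_trans h2).
    by rewrite [C * _]mulrC -!mulrA.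
  + move=> k; apply: le_trans (ler_wpM2r _ (hD k)); last first.
      by rewrite !mulr_ge0// ltW.
    by rewrite mulr_suml; apply: ler_sum => j _; rewrite mulrA.
- move=> K k0 hK; have ga0 : 0 < `|real_part p phi a| by rewrite normr_gt0.
  pose q := (K + B (p, [::]) * 2) / `|real_part p phi a|.
  pose k := maxn k0 (Num.truncn q).+1.
  have := hump k; have := hK k (leq_maxl _ _); rewrite real_part_cseries => h1 h2.
  have : k%:R * `|real_part p phi a| <= K + B (p, [::]) * 2.
    by apply: le_trans h2 _; rewrite lerD2r.
  rewrite -ler_pdivlMr// -/q leNgt => /negP; apply.
  apply: (lt_le_trans (Num.Theory.truncnS_gt q)); rewrite ler_nat; exact: leq_maxr.
Qed.

End test_function.

Section inclusion.
Context {R : realType}.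

(** A geometric majorant from some rank on is enough: in the Beurling case the
    weight in question is dominated by wt j only for large j. *)
Lemma sum_bound_tail (b : nat -> R) J : (forall j, 0 <= b j) ->
  (forall j, (J <= j)%N -> b j <= 2^-1 ^+ j) ->
  exists D, forall k, \sum_(0 <= j < k) b j <= D.
Proof.
move=> b0 hb; exists (\sum_(0 <= j < J) b j + 2) => k.
have step l : (J <= l)%N -> \sum_(0 <= j < l) b j <= \sum_(0 <= j < J) b j + 2.
  move=> Jl; rewrite (big_cat_nat (leq0n J) Jl) /= lerD2l.
  apply: le_trans (@geometric_half_le R J l); rewrite big_seq [leRHS]big_seq.
  by apply: ler_sum => j; rewrite mem_index_iota => /andP[Jj _]; exact: hb.
apply: le_trans (step (maxn J k) (leq_maxl _ _)).
by rewrite (big_cat_nat (leq0n k) (leq_maxr J k)) /= lerDl sumr_ge0.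
Qed.

Lemma posnum_inv_small (l : {posnum R}) :
  exists J, forall j, (J <= j)%N -> j.+1%:R^-1 <= l%:num.
Proof.
exists (Num.truncn (l%:num^-1)) => j Jj.
rewrite invf_ple ?posrE//; apply: le_trans (ltW (Num.Theory.truncnS_gt _)) _.
by rewrite ler_nat ltnS.
Qed.

Lemma posnum_nat_large (l : {posnum R}) :
  exists J, forall j, (J <= j)%N -> l%:num <= j.+1%:R.
Proof.
exists (Num.truncn l%:num) => j Jj.
by apply: le_trans (ltW (Num.Theory.truncnS_gt _)) _; rewrite ler_nat ltnS.
Qed.

Lemma posnum_lower_bound (l m : {posnum R}) :
  exists k : {posnum R}, k%:num <= l%:num /\ k%:num <= m%:num.
Proof. by have [lm|/ltW ml] := leP l%:num m%:num; [exists l|exists m]. Qed.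

Lemma posnum_upper_bound (l m : {posnum R}) :
  exists k : {posnum R}, l%:num <= k%:num /\ m%:num <= k%:num.
Proof. by have [lm|/ltW ml] := leP l%:num m%:num; [exists m|exists l]. Qed.

Context {n : nat}.

Lemma not_dominated (v w : 'rV[R]_n -> R) : (forall t, 1 <= w t) ->
  ~ (exists2 C : R, 0 < C & forall t, v t <= C * w t) ->
  forall C, exists x, C * w x < v x.
Proof.
move=> w1 nd C; apply: contrapT => nex; apply: nd.
exists (Num.max C 1); first by rewrite lt_max ltr01 orbT.
move=> t; rewrite leNgt; apply/negP => ht; apply: nex; exists t.
apply: le_lt_trans ht; rewrite ler_wpM2r ?(le_trans _ (w1 t))//.
by rewrite le_max lexx.
Qed.

Context (E : set ('rV[R]_n -> R[i])) (N : ('rV[R]_n -> R[i]) -> R).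
Context (hE : TIBF_bounded_type E N).

Lemma GS_space_nonzero b (M : {posnum R} -> {ffun 'I_n -> nat} -> R) W :
  weight_sequence_system M -> GS_space b E N M W <> [set (fun=> 0)] ->
  exists2 phi, GS_space b E N M W phi & phi <> (fun=> 0).
Proof.
move=> [hM _] hne; apply: contrapT => nex; apply: hne; apply/seteqP; split.
  by move=> f Gf; apply: contrapT => f0; apply: nex; exists f.
have z l : EMw E N (M l) (W l) (fun=> 0) by apply: EMw0 => //; have [] := hM l.
by move=> _ ->; clear nex; case: b => [l _|]; [exact: z|exists 1%:pos].
Qed.

(** [wM] compares v' at x with v on the cube at x, as weighted_sup_bound requires. *)
Lemma pointwise_decay (M : {ffun 'I_n -> nat} -> R) (v v' : 'rV[R]_n -> R) C f p :
  EMw E N M v f -> 0 < C -> (forall t, 0 <= v' t) ->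
  (forall x y, unit_ball y -> v' (x + y) <= C * v x) ->
  exists K, forall x, `|real_part p f x| * v' x <= K.
Proof.
move=> hf C0 v'0 hv.
have [x|x y yQ|K hK] := weighted_sup_bound hE p [::] hf (c := fun x => v' x / C).
- by rewrite divr_ge0// ltW.
- rewrite ler_pdivrMr// mulrC -{1}(addrK y x); apply: hv; exact: cube_unit_ball.
exists (K * C) => x; rewrite -ler_pdivrMr//; apply: le_trans (hK x).
by rewrite /= [leRHS]mulrC mulrA.
Qed.

End inclusion.

Unset Implicit Arguments.

Theorem theorem3p1 (b : bracket) (R : realType) (n : nat)
    (E : set ('rV[R]_n -> R[i])) (normE : ('rV[R]_n -> R[i]) -> R)
    (M N : {posnum R} -> {ffun 'I_n -> nat} -> R)
    (W V : {posnum R} -> 'rV[R]_n -> R)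
    (hE : TIBF_bounded_type E normE) (hEsolid : solid E normE)
    (hM : weight_sequence_system M) (hN : weight_sequence_system N)
    (hW : weight_function_system W) (hV : weight_function_system V)
    (hML : cond_L b M) (hMwI : cond_wI b M) (hNL : cond_L b N)
    (hWM : cond_M b W) (hVwM : cond_wM b V)
    (hne : GS_space b E normE M W <> [set (fun=> 0)])
    (hsub : GS_space b E normE M W `<=` GS_space b E normE N V) :
  wfs_incl b W V.
Proof.
have [phi hphi phi0] := GS_space_nonzero hE hM hne.
have W1 l t : 1 <= W l t by have [_] := hW.1 l; exact.
have V1 l t : 1 <= V l t by have [_] := hV.1 l; exact.
have cW l : continuous (W l) by have [] := hW.1 l.
have M0 l a : 0 < M l a by have [/(_ a)] := hM.1 l.
have W0 l t : 0 <= W l t by exact: le_trans (W1 l t).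
have V0 l t : 0 <= V l t by exact: le_trans (V1 l t).
have Mle := hM.2; have Wle := hW.2; have Vle := hV.2.
case: b hML hMwI hNL hWM hVwM hne hsub hphi => _ _ _ hWM hVwM _ hsub hphi.
- rewrite /wfs_incl /= => l; apply: contrapT => nex.
  have pos (j : nat) : 0 < j.+1%:R^-1 :> R by rewrite invr_gt0.
  pose wt j := W (PosNum (pos j)).
  have unb j C : exists x, C * wt j x < V l x.
    apply: (@not_dominated R n (V l) (wt j)) => [t|h]; first exact: W1.
    by apply: nex; eexists; exact: h.
  have [f [p [a [x [c [cwt hf hump]]]]]] := exists_test_series hE hEsolid
    (M0 1%:pos) (W1 1%:pos) (hphi _ I) phi0 (fun j => W1 _) (fun j => V1 l) unb.
  have Gf : GS_space Beurling E normE M W f.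
    move=> m _; have [mu [nu [C C0 hC]]] := hWM m.
    have [nu1 [nu2 [C' C'0 hC']]] := hWM nu.
    (* One step k has both M k <= M m and W mu <= W k. *)
    have [k [km kmu]] := posnum_lower_bound m mu.
    have [J hJ] := posnum_inv_small nu1.
    have [D hD] : exists D, forall k, \sum_(0 <= j < k) `|c j| * W nu1 (x j) <= D.
      apply: (@sum_bound_tail _ _ J) => [j|j Jj]; first exact: mulr_ge0.
      apply: le_trans (cwt j); rewrite ler_wpM2l//; apply: Wle; exact: hJ.
    apply: (hf (M m) (M k) (W m) (W k) (C * C' * W nu2 (- a)) D (W nu1)) => //.
    + exact: hphi.
    + by move=> d; exact: Mle.
    + by rewrite !mulr_ge0// ltW.
    move=> t z.
    have -> : W m t = W m ((t - (z - a)) + (z - a)) by rewrite subrK.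
    apply: (le_trans (hC _ _)).
    have h1 : W mu (t - (z - a)) <= W k (t - (z - a)).
      exact: Wle.
    have h2 : W nu (z - a) <= C' * W nu1 z * W nu2 (- a) by exact: hC'.
    rewrite -mulrA; apply: le_trans (ler_wpM2l (ltW C0) (ler_pM (W0 _ _) (W0 _ _) h1 h2)) _.
    by rewrite le_eqVlt; apply/orP; left; apply/eqP; ring.
  have [l' [C C0 hC]] := hVwM l.
  have [K hK] := pointwise_decay hE p (hsub _ Gf l' I) C0 (V0 l) hC.
  by apply: (hump K 0%N) => k _; exact: hK.
- rewrite /wfs_incl /= => m; apply: contrapT => nex.
  have [k _ hphik] := hphi.
  have pos (j : nat) : 0 < j.+1%:R :> R by [].
  pose vt j := V (PosNum (pos j)).
  have unb j C : exists x, C * W m x < vt j x.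
    apply: (@not_dominated R n (vt j) (W m)) => [t|h]; first exact: W1.
    by apply: nex; eexists; exact: h.
  have [f [p [a [x [c [cwt hf hump]]]]]] := exists_test_series hE hEsolid
    (M0 k) (W1 k) hphik phi0 (fun j => W1 m) (fun j => V1 _) unb.
  have Gf : GS_space Roumieu E normE M W f.
    (* Applied to k and k, [M] absorbs the shift by a; applied to m and s, it
       separates the centre z from t - z. *)
    have [s [C' C'0 hC']] := hWM k k; have [l0 [C C0 hC]] := hWM m s.
    have [l [l0l kl]] := posnum_upper_bound l0 k.
    exists l => //.
    apply: (hf (M l) (M k) (W l) (W k) (C * C' * W k (- a)) 2 (W m)) => //.
    + by move=> d; exact: Mle.
    + by rewrite !mulr_ge0// ltW.
    + move=> t z.
      have h0 : W l t <= W l0 t by exact: Wle.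
      apply: (le_trans h0).
      have -> : W l0 t = W l0 (z + (t - z)) by rewrite addrC subrK.
      apply: (le_trans (hC _ _)).
      have h2 : W s (t - z) <= C' * W k (t - (z - a)) * W k (- a).
        have -> : t - z = t - (z - a) + - a by rewrite opprB addrA addrAC addrK.
        exact: hC'.
      apply: le_trans (ler_wpM2l _ h2) _; first by rewrite mulr_ge0// ltW.
      by rewrite le_eqVlt; apply/orP; left; apply/eqP; ring.
    move=> q; apply: le_trans (@geometric_half_le R 0 q); apply: ler_sum => j _.
    exact: cwt.
  have [s _ hfs] := hsub _ Gf.
  have [l' [C C0 hC]] := hVwM s; have [J hJ] := posnum_nat_large l'.
  have [K hK] := pointwise_decay hE p hfs C0 (V0 l') hC.
  apply: (hump K J) => j Jj; apply: le_trans (hK (x j)).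
  by rewrite ler_wpM2l//; apply: Vle; exact: hJ.
Qed.
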